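(* Let $k\ge 0$ be an integer. The main component $\Sigma$ of a generic spectral curve $\Sigma'$ (of a non-isotropic almost-complex immersion $f:\mathbb{C}\to S^6$ of finite type with polynomial Killing field of degree $6k+1$) is smooth, with genus $5(6k+1)$. The real dimension of the moduli of such curves $\Sigma$ is $16k+4$.
   Context: Let $S^6$ be the unit sphere in the imaginary octonions, $G_2\subset SO(7)$ the automorphism group of the octonions, $\mathfrak{g}_2^{\mathbb{C}}\subset \mathfrak{so}(7,\mathbb{C})$ its complexified Lie algebra, $\rho(A)=\overline{A}$, $\epsilon=e^{\pi i/3}$, $R_\theta$ the $2\times2$ rotation matrix, $\tau=\mathrm{Ad}_C$ with $C=\mathrm{diag}(1,R_{\pi/3},R_{2\pi/3},R_{\pi})$, and $\mathfrak{g}_j$ the $\epsilon^{j}$-eigenspace of $\tau$ on $\mathfrak{g}_2^{\mathbb{C}}$ ($j$ mod 6). Polynomial Killing fields. A polynomial Killing field of degree $d=6k+1$ is a map $A'_\zeta(z)=\sum_{j=-d}^{d}A_j(z)\zeta^j$, $z\in\mathbb{C}$, $\zeta\in\mathbb{C}^*$, with $A_j\in\mathfrak{g}_j$, $A_{-j}=\rho(A_j)$ (so $\rho(A'_\zeta)=A'_{\bar\zeta^{-1}}$, $\tau(A'_\zeta)=A'_{\epsilon\zeta}$), satisfying $dA'=[A',\varphi_\zeta]$ with $\varphi_\zeta=(A_{d-1}+A_d\zeta)dz+(A_{1-d}+A_{-d}\zeta^{-1})d\bar z$. A non-isotropic almost-complex immersion $f:\mathbb{C}\to S^6$ is of finite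 type if it has a framing $F:\mathbb{C}\to G_2$ with first column $f$ and $F^{-1}dF=\varphi_{1}$ for some polynomial Killing field. Spectral curve. The nonzero eigenvalues of $A'_\zeta(z)$ are $\pm\mu_1,\pm\mu_2,\pm\mu_3$ with $\mu_1+\mu_2+\mu_3=0$, and $$\det(\mu\,\mathrm{id}-A'_\zeta(z))=\mu\Big(\mu^6-a_1\mu^4+\tfrac{a_1^2}{4}\mu^2-a_2\Big),\quad a_1=\mu_1^2+\mu_2^2+\mu_3^2,\ a_2=(\mu_1\mu_2\mu_3)^2,$$ independent of $z$. Regarding $A'_\zeta(z)$ as a section of $\mathcal{O}(2(6k+1))\otimes\mathrm{End}(\mathbb{C}^7)$ over $\mathbb{P}^1_\zeta$ (by multiplying by $\zeta^{6k+1}$ near $\zeta=0$ and by $\zeta^{-(6k+1)}$ near $\zeta=\infty$), this polynomial defines a reducible curve $\hat\Sigma'$ in the total space of $\mathcal{O}(2(6k+1))$, with tautological section $\mu$; one component is $\mathbb{P}^1$ ($\mu=0$), the other, $\hat\Sigma$, is given by $\mu^6-a_1\mu^4+\frac{a_1^2}{4}\mu^2-a_2=0$. The symmetry $\tau$ acts by $(\zeta,\mu)\mapsto(\epsilon\zeta,\mu)$, and $a_j(\zeta)=b_j(\lambda)$ with $\lambda=\zeta^6$. The spectral curve is $\Sigma'=\hat\Sigma'/\tau$ and its main component is $\Sigma=\hat\Sigma/\tau$, a six-sheeted cover of $\mathbb{P}^1_\lambda$ given (over $\lambda\in\mathbb{C}^*$) by $\eta^6-b_1\eta^4+\frac{b_1^2}{4}\eta^2-b_2=0$.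 Here $(b_1,b_2)$ lies in $B=H^0(\mathbb{P}^1_\lambda,\mathcal{O}(4k))\oplus H^0(\mathbb{P}^1_\lambda,\mathcal{O}(12k+2))$, i.e. $b_1$ and $b_2$ are Laurent polynomials in $\lambda$ with exponents in $[-2k,2k]$ and $[-(6k+1),6k+1]$ respectively, and satisfies the reality condition $\overline{b_j(\lambda)}=b_j(\bar\lambda^{-1})$. Let $B_{\mathbb{R}}\subset B$ be the real subspace defined by this condition. The curves $\Sigma$ are parametrised by points $(b_1,b_2)$ of $B_{\mathbb{R}}$ (this is the moduli referred to), and ''generic'' means for $(b_1,b_2)$ outside a lower-dimensional subvariety of $B_{\mathbb{R}}$. *)

(* Defs.v *)
From HB Require Import structures.
From mathcomp Require Import all_boot all_order all_algebra.
From mathcomp Require Import complex.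
From mathcomp Require mpoly.
(* The notations of mpoly clash with those of mathcomp-analysis. *)
Import(canonicals) mpoly.
From mathcomp Require Import all_classical all_reals all_analysis.

Set Implicit Arguments.
Unset Strict Implicit.
Unset Printing Implicit Defensive.

Import Order.TTheory GRing.Theory Num.Theory.
Import numFieldNormedType.Exports.

Local Open Scope complex_scope.
Local Open Scope ring_scope.

Definition cyclic_rotations (t : nat * nat * nat) : seq (nat * nat * nat) :=
  let: (i, j, l) := t in [:: (i, j, l); (j, l, i); (l, i, j)].

(* The basis e_0, ..., e_6 of Im O is chosen so that e_0, (e_1, e_2),
   (e_3, e_4), (e_5, e_6) are the blocks of C below; the associative 3-form is
   e^012 + e^034 + e^056 + e^135 - e^146 - e^236 - e^245. *)
Definition oct_triples : seq (nat * nat * nat) :=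
  flatten [seq cyclic_rotations t | t <-
    [:: (0, 1, 2); (0, 3, 4); (0, 5, 6);
        (1, 3, 5); (1, 6, 4); (2, 6, 3); (2, 5, 4)]]%N.

Definition oct_coef (K : pzRingType) (i j l : 'I_7) : K :=
  if (val i, val j, val l) \in oct_triples then 1
  else if (val j, val i, val l) \in oct_triples then -1 else 0.

(* Imaginary part of the octonion product of two imaginary octonions; the full
   product is (a, u) (b, v) = (a b - <u, v>, a v + b u + u x v). *)
Definition cross (K : pzRingType) (u v : 'cV[K]_7) : 'cV[K]_7 :=
  \col_l \sum_i \sum_j oct_coef K i j l * u i 0 * v j 0.

Definition dot (K : pzRingType) (u v : 'cV[K]_7) : K := \sum_i u i 0 * v i 0.

(* Automorphisms of O fix 1 and preserve Im O, hence are given by their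
   restriction g to Im O = R^7. *)
Definition in_G2 (K : pzRingType) (g : 'M[K]_7) : Prop :=
  forall u v : 'cV[K]_7,
    dot (g *m u) (g *m v) = dot u v /\
    cross (g *m u) (g *m v) = g *m cross u v.

(* Over the complex numbers: the derivations of the complexified octonions. *)
Definition in_Lie_G2 (K : pzRingType) (X : 'M[K]_7) : Prop :=
  forall u v : 'cV[K]_7,
    dot (X *m u) v + dot u (X *m v) = 0 /\
    X *m cross u v = cross (X *m u) v + cross u (X *m v).

Section ComplexGeometry.
Variable R : realType.
Local Notation C := (complex R).
Local Notation plane := (R^o * R^o)%type.

Definition epsilon : C := Complex (cos (pi / 3)) (sin (pi / 3)).

Definition rot (t : R) : 'M[R]_2 :=
  \matrix_(i, j) (if i == j then cos t
                  else if (i < j)%N then - sin t else sin t).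

Definition Cmat : 'M[R]_7 :=
  block_mx (1%:M : 'M[R]_1) (0 : 'M[R]_(1, 6)) 0
    (block_mx (rot (pi / 3)) (0 : 'M[R]_(2, 4)) 0
      (block_mx (rot (2 * pi / 3)) (0 : 'M[R]_(2, 2)) 0 (rot pi))).

Definition complexify m n (M : 'M[R]_(m, n)) : 'M[C]_(m, n) :=
  map_mx (fun x => x%:C) M.

Definition tau (X : 'M[C]_7) : 'M[C]_7 :=
  complexify Cmat *m X *m invmx (complexify Cmat).

Definition in_g (j : int) (X : 'M[C]_7) : Prop :=
  in_Lie_G2 X /\ tau X = epsilon ^ j *: X.

(* The complex plane is the real normed space [plane], in which [to_complex z]
   is the complex coordinate; dz(u) = to_complex u. *)
Definition to_complex (u : plane) : C := Complex u.1 u.2.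

Fixpoint Ck (n : nat) (h : plane -> R^o) : Prop :=
  match n with
  | 0%N => continuous h
  | m.+1 => (forall z u, derivable h z u) /\ (forall u, Ck m ('D_u h))
  end.

Definition smooth_fun (h : plane -> R^o) : Prop := forall n, Ck n h.

Definition smooth_mx m n (M : plane -> 'M[R]_(m, n)) : Prop :=
  forall i j, smooth_fun (fun z => M z i j).

Definition smooth_cmx m n (M : plane -> 'M[C]_(m, n)) : Prop :=
  forall i j, smooth_fun (fun z => complex.Re (M z i j)) /\
              smooth_fun (fun z => complex.Im (M z i j)).

Definition cderive (u : plane) (h : plane -> C) (z : plane) : C :=
  Complex ('D_u (fun w => complex.Re (h w) : R^o) z)
          ('D_u (fun w => complex.Im (h w) : R^o) z).

(* The 1-form dM at z evaluated on the tangent vector u. *)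
Definition dmx m n (M : plane -> 'M[R]_(m, n)) (z u : plane) : 'M[R]_(m, n) :=
  \matrix_(i, j) 'D_u (fun w => M w i j : R^o) z.

Definition dcmx m n (M : plane -> 'M[C]_(m, n)) (z u : plane) : 'M[C]_(m, n) :=
  \matrix_(i, j) cderive u (fun w => M w i j) z.

Section KillingField.
Variables (d : nat) (A : int -> plane -> 'M[C]_7).

(* Only the A_j with - d <= j <= d matter. *)
Definition killing (zeta : C) (z : plane) : 'M[C]_7 :=
  \sum_(j < d.*2.+1) zeta ^ (j%:Z - d%:Z) *: A (j%:Z - d%:Z) z.

Definition phi (zeta : C) (z u : plane) : 'M[C]_7 :=
  to_complex u *: (A (d%:Z - 1) z + zeta *: A d%:Z z)
  + (to_complex u)^* *: (A (1 - d%:Z) z + zeta^-1 *: A (- d%:Z) z).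

Definition polynomial_killing_field : Prop :=
  [/\ forall j : int, (`|j| <= d%:Z) ->
        smooth_cmx (A j) /\ forall z, in_g j (A j z),
      forall (j : int) (z : plane), (`|j| <= d%:Z) ->
        A (- j) z = map_mx (fun x : C => x^*) (A j z)
    & forall (zeta : C) (z u : plane), zeta != 0 ->
        dcmx (killing zeta) z u =
        killing zeta z *m phi zeta z u - phi zeta z u *m killing zeta z].

End KillingField.

Definition almost_complex_immersion (f : plane -> 'cV[R]_7) : Prop :=
  [/\ smooth_mx f,
      forall z, dot (f z) (f z) = 1,
      forall z u : plane,
        dmx f z (- u.2, u.1) = cross (f z) (dmx f z u)
    & forall z u : plane, u != 0 -> dmx f z u != 0].

Definition d_z (h : plane -> C) (z : plane) : C :=
  2^-1 * (cderive (1, 0) h z - Complex 0 1 * cderive (0, 1) h z).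

(* All the derivatives of f with respect to z, of order at least 1, are
   mutually orthogonal for the complex bilinear extension of the metric. *)
Definition isotropic (f : plane -> 'cV[R]_7) : Prop :=
  forall (m n : nat) (z : plane), (0 < m)%N -> (0 < n)%N ->
    \sum_i iter m d_z (fun w => (f w i 0)%:C) z
         * iter n d_z (fun w => (f w i 0)%:C) z = 0.

Definition finite_type_with (f : plane -> 'cV[R]_7) (d : nat)
    (A : int -> plane -> 'M[C]_7) : Prop :=
  polynomial_killing_field d A /\
  exists F : plane -> 'M[R]_7,
    [/\ smooth_mx F,
        forall z, in_G2 (F z),
        forall z, col 0 (F z) = f z
      & forall z u, invmx (complexify (F z)) *m complexify (dmx F z u)
                    = phi d A 1 z u].

(* The total space of O(2d) over the zeta-line is glued from two copies of
   C^2, with coordinates (zeta, m) and (w, n), where w = zeta^-1 and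
   n = zeta^(-2d) m; the eigenvalue is mu = zeta^(-d) m = zeta^d n.
   A function of (zeta, m) is an element of {poly {poly C}}, the
   outer variable being the fibre coordinate m; likewise for (w, n).
   A curve is given by an equation in each chart. *)
Record cover := Cover {
  halfdeg : nat;
  eq0 : {poly {poly C}};
  eqinf : {poly {poly C}}
}.

Definition eval2 (f : {poly {poly C}}) (a b : C) : C := f.[b%:P].[a].

(* (x, y) |-> (u x, v y) *)
Definition act2 (u v : C) (f : {poly {poly C}}) : {poly {poly C}} :=
  map_poly (comp_poly (u *: 'X)) f \Po (v%:P *: 'X).

Definition in_ideal (A : comNzRingType) (P f : A) : Prop := exists q, f = q * P.

(* Functions on the quotient of {P = 0} by the cyclic group generated by
   (x, y) |-> (u x, v y): the invariant functions on {P = 0}.  They are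
   represented by polynomials, to be read modulo P. *)
Definition invariant (P : {poly {poly C}}) (u v : C) (f : {poly {poly C}}) :=
  in_ideal P (act2 u v f - f).

(* The maximal ideal of the image of (a, b) in the quotient, and its square. *)
Definition max_ideal P u v (a b : C) (f : {poly {poly C}}) : Prop :=
  invariant P u v f /\ eval2 f a b = 0.

Definition max_ideal_sq P u v (a b : C) (f : {poly {poly C}}) : Prop :=
  exists (r : nat) (g h : 'I_r -> {poly {poly C}}),
    (forall i, max_ideal P u v a b (g i) /\ max_ideal P u v a b (h i)) /\
    in_ideal P (f - \sum_i g i * h i).

(* For P monic in the second variable, the quotient is purely one-dimensional:
   it is smooth at a point iff the cotangent space m / m^2 is a line. *)
Definition smooth_chart (P : {poly {poly C}}) (u v : C) : Prop :=
  forall a b : C, eval2 P a b = 0 ->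
    exists t, [/\ max_ideal P u v a b t, ~ max_ideal_sq P u v a b t &
      forall f, max_ideal P u v a b f ->
        exists c : C, max_ideal_sq P u v a b (f - c%:P%:P * t)].

Section Quotient.
Variable S : cover.
Local Notation d := (halfdeg S).

(* In the two charts, tau : (zeta, mu) |-> (epsilon zeta, mu) is diagonal, since
   m = zeta^d mu and n = zeta^(-d) mu. *)
Definition inv0 := invariant (eq0 S) epsilon (epsilon ^+ d).
Definition invinf := invariant (eqinf S) epsilon^-1 (epsilon ^- d).

Definition smooth_quotient : Prop :=
  smooth_chart (eq0 S) epsilon (epsilon ^+ d) /\
  smooth_chart (eqinf S) epsilon^-1 (epsilon ^- d).

(* Functions on the overlap zeta <> 0 are polynomials in (zeta, w, m), with m
   the outer and zeta the inner variable, modulo zeta w = 1 and [eq0 S]. *)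
Local Notation poly3 := {poly {poly {poly C}}}.

Definition res0 (f : {poly {poly C}}) : poly3 := map_poly polyC f.

Definition resinf (f : {poly {poly C}}) : poly3 :=
  map_poly (map_poly polyC) f \Po ('X^(d.*2) *: 'X).

Definition in_ideal01 (F : poly3) : Prop :=
  exists q r : poly3, F = q * ('X%:P * 'X - 1)%:P + r * res0 (eq0 S).

Definition act3 (F : poly3) : poly3 :=
  map_poly (act2 epsilon epsilon^-1) F \Po ((epsilon ^+ d)%:P%:P *: 'X).

Definition inv01 (F : poly3) : Prop := in_ideal01 (act3 F - F).

(* Cech cohomology of the structure sheaf of the quotient by tau, for the
   affine cover by the (images of the) two charts. *)
Definition h0_eq1 : Prop :=
  forall f g, inv0 f -> invinf g -> in_ideal01 (res0 f - resinf g) ->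
    exists! c : C,
      in_ideal (eq0 S) (f - c%:P%:P) /\ in_ideal (eqinf S) (g - c%:P%:P).

Definition coboundary (F : poly3) : Prop :=
  exists f g, [/\ inv0 f, invinf g & in_ideal01 (F - (res0 f - resinf g))].

Definition h1_eq (n : nat) : Prop :=
  exists e : 'I_n -> poly3, (forall i, inv01 (e i)) /\
    forall F, inv01 F -> exists! c : 'rV[C]_n,
      coboundary (F - \sum_i (c 0 i)%:P%:P%:P * e i).

(* The genus of a connected smooth projective curve X is dim H^1(X, O_X). *)
Definition has_genus (g : nat) : Prop := h0_eq1 /\ h1_eq g.

End Quotient.

(* det(m - zeta^d A'_zeta), resp. det(n - zeta^(-d) A'_zeta); 0 is always a
   root, and dropping it leaves the main component. *)
Definition killing0 (d : nat) (A : int -> plane -> 'M[C]_7) (z : plane) :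
    'M[{poly C}]_7 :=
  \sum_(j < d.*2.+1) 'X^j *: map_mx polyC (A (j%:Z - d%:Z) z).

Definition killinginf (d : nat) (A : int -> plane -> 'M[C]_7) (z : plane) :
    'M[{poly C}]_7 :=
  \sum_(j < d.*2.+1) 'X^(d.*2 - j) *: map_mx polyC (A (j%:Z - d%:Z) z).

Definition main_component_of (d : nat) (A : int -> plane -> 'M[C]_7)
    (z : plane) : cover :=
  Cover d (drop_poly 1 (char_poly (killing0 d A z)))
          (drop_poly 1 (char_poly (killinginf d A z))).

(* A Laurent polynomial with exponents in [-N, N] is the row of its
   coefficients, the j-th entry being the coefficient of lambda^(j - N). *)
Definition laurent N (b : 'rV[C]_(N.*2.+1)) (lambda : C) : C :=
  \sum_(j < N.*2.+1) b 0 j * lambda ^ (j%:Z - N%:Z).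

(* Coefficients of (b_1, b_2) in H^0(P^1, O(4k)) + H^0(P^1, O(12k+2)). *)
Local Notation spectral_coeffs k :=
  ('rV[C]_(k.*2.*2.+1) * 'rV[C]_((6 * k + 1).*2.+1))%type.

Definition real_laurent N (b : 'rV[C]_(N.*2.+1)) : Prop :=
  forall lambda : C, lambda != 0 ->
    (laurent b lambda)^* = laurent b (lambda^*)^-1.

Definition BR k (b : spectral_coeffs k) : Prop :=
  real_laurent b.1 /\ real_laurent b.2.

(* zeta^e b(zeta^6) as a polynomial in zeta, and w^e b(w^-6) as a polynomial
   in w, when e >= 6 N. *)
Definition cleared0 N (e : nat) (b : 'rV[C]_(N.*2.+1)) : {poly C} :=
  \sum_(j < N.*2.+1) b 0 j *: 'X^(6 * j + (e - 6 * N)).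

Definition clearedinf N (e : nat) (b : 'rV[C]_(N.*2.+1)) : {poly C} :=
  \sum_(j < N.*2.+1) b 0 j *: 'X^(6 * (N.*2 - j) + (e - 6 * N)).

Definition sextic (A : comUnitRingType) (a1 a2 : A) : {poly A} :=
  'X^6 - a1 *: 'X^4 + (a1 ^+ 2 / 4) *: 'X^2 - a2%:P.

Definition Sigma k (b : spectral_coeffs k) :
    cover :=
  let d := (6 * k + 1)%N in
  Cover d (sextic (cleared0 d.*2 b.1) (cleared0 (6 * d) b.2))
          (sextic (clearedinf d.*2 b.1) (clearedinf (6 * d) b.2)).

Definition spectral_data k (A : int -> plane -> 'M[C]_7)
    (b : spectral_coeffs k) : Prop :=
  forall (zeta : C) (z : plane), zeta != 0 ->
    char_poly (killing (6 * k + 1) A zeta z)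
    = 'X * sextic (laurent b.1 (zeta ^+ 6)) (laurent b.2 (zeta ^+ 6)).

Section RealSubspace.
Variables (E : lmodType C) (V : E -> Prop).

Definition real_comb n (e : 'I_n -> E) (x : 'rV[R]_n) : E :=
  \sum_i (x 0 i)%:C *: e i.

Definition real_basis n (e : 'I_n -> E) : Prop :=
  injective (real_comb e) /\ forall v, V v <-> exists x, v = real_comb e x.

Definition real_dim (n : nat) : Prop := exists e : 'I_n -> E, real_basis e.

(* Z is the common zero set in V of a family of real polynomials, and has
   smaller dimension than V: the coordinates of V satisfy a nontrivial
   polynomial relation on Z. *)
Definition lower_dim_subvariety (Z : E -> Prop) : Prop :=
  exists n (e : 'I_n -> E) (I : mpoly.mpoly n R -> Prop),
    [/\ real_basis e,
        exists2 p, I p & p != 0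
      & forall v, Z v <-> exists2 x, v = real_comb e x &
          forall p, I p -> mpoly.meval (fun i => x 0 i) p = 0].

End RealSubspace.

End ComplexGeometry.

(* Main.v *)
(** In the chart at zeta = 0 the curve is Q^2 = a_2 with Q = m^3 - a_1 m / 2,
    where a_1 = zeta^2 beta_1(zeta^6), a_2 = beta_2(zeta^6), and the order six
    symmetry is (zeta, m) |-> (eps zeta, eps m); by the reality condition the
    chart at infinity is the complex conjugate one.

    Genus.  Everything is read off fibrewise in zeta: modulo the monic sextic,
    a function on the overlap is sum_(j < 6) F_j(zeta) m^j with F_j a Laurent
    polynomial, and it is invariant iff zeta^i m^j occurs only for 6 | i + j.
    The first chart contributes i >= 0 and the second one i <= - 2 d j, so that
    H^1 has basis zeta^(-s) m^j with 0 < j < 6, 0 < s < 2 d j, s = j mod 6: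
    these are 5 (6 k + 1) monomials, whatever the coefficients are.

    Smoothness.  A critical point of the sextic lies over a double root of a_2
    or of 54 a_2 - a_1^3.  If beta_2(0) <> 0 the action on the curve is free,
    and at (a, b) with a <> 0 the cotangent space of the quotient of the plane
    is spanned by x^6 - a^6 and x^5 y - a^5 b, so that a nonzero gradient of the
    sextic leaves a line.  The exceptional set is the vanishing locus of
    beta_2(0) disc(beta_2) disc(54 beta_2 - lambda beta_1^3), which is not
    everything because of beta_1 = 0, beta_2 = lambda^(12 k + 2) + 1.

    Spectral data.  The characteristic polynomials in the two charts are
    determined by their values at zeta <> 0, where the spectral data give them,
    so that the main component is Sigma itself. *)
From HB Require Import structures.
Require Import Defs.
From mathcomp Require Import all_boot all_order all_algebra.
From mathcomp Require Import complex.
From mathcomp Require mpoly.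
Import(canonicals) mpoly.
From mathcomp Require Import all_classical all_reals all_analysis.
From mathcomp Require Import ring lra zify.

Set Implicit Arguments.
Unset Strict Implicit.
Unset Printing Implicit Defensive.

Import Order.TTheory GRing.Theory Num.Theory.

Local Open Scope ring_scope.

(** * Fibres over the base line *)

Local Notation fiber a := (map_poly (horner_eval a)).

Section Laurent.
Variable K : numFieldType.
Implicit Types (p h : {poly K}) (f g : {poly {poly K}}) (a b : K).

(** In characteristic zero 1, ..., [size p] are distinct nonzero points, and a nonzero polynomial
    has fewer than [size p] roots. *)
Lemma poly_eq0_punctured p : (forall a, a != 0 -> p.[a] = 0) -> p = 0.
Proof.
move=> p0; apply/eqP/negPn/negP => pN0.
pose s : seq K := [seq i.+1%:R | i <- iota 0 (size p)].
have us : uniq s.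
  rewrite map_inj_uniq ?iota_uniq// => i j /eqP.
  by rewrite eqr_nat => /eqP[].
have rs : all (root p) s.
  by apply/allP => x /mapP[i _ ->]; apply/eqP/p0; rewrite pnatr_eq0.
by have := max_poly_roots pN0 rs us; rewrite size_map size_iota ltnn.
Qed.

Lemma poly_eq_punctured p q : (forall a, a != 0 -> p.[a] = q.[a]) -> p = q.
Proof.
move=> pq; apply/eqP; rewrite -subr_eq0; apply/eqP/poly_eq0_punctured => a a0.
by rewrite hornerD hornerN pq ?subrr.
Qed.

Definition rev_poly n h : {poly K} := \poly_(i < n.+1) h`_(n - i).

Lemma horner_rev_poly n h a : (size h <= n.+1)%N -> a != 0 ->
  (rev_poly n h).[a] = a ^+ n * h.[a^-1].
Proof.
move=> hn a0; rewrite horner_poly (horner_coef_wide _ hn) mulr_sumr.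
rewrite (reindex_inj rev_ord_inj)/=; apply: eq_bigr => i _.
rewrite subSS subKn; last by rewrite -ltnS.
by rewrite exprVn mulrCA -exprB ?unitfE// -ltnS.
Qed.

(** Global functions on the projective line are constant: X^n p has only exponents at least n and
    the reversal of h only exponents at most n, so just the exponent n survives. *)
Lemma laurent_eq p h : (forall a, a != 0 -> p.[a] = h.[a^-1]) ->
  p = (h`_0)%:P /\ h = (h`_0)%:P.
Proof.
move=> ph; set n := size h.
have E : 'X^n * p = rev_poly n h.
  apply: poly_eq_punctured => a a0.
  by rewrite horner_rev_poly// hornerM hornerXn ph.
have C i : (if (i < n)%N then 0 else p`_(i - n)) =
    if (i < n.+1)%N then h`_(n - i) else 0.
  by rewrite -coefXnM E coef_poly.
split; apply/polyP => i; rewrite coefC.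
  have := C (n + i)%N; rewrite ltnNge leq_addr/= addKn => ->.
  rewrite ltnS; case: eqP => [->|/eqP i0]; first by rewrite addn0 leqnn subnn.
  by rewrite leqNgt -[X in (X < _)%N]addn0 ltn_add2l lt0n i0.
case: eqP => [->//|/eqP i0]; have [ni|lin] := leqP n i; first by rewrite nth_default.
have := C (n - i)%N; rewrite ltn_subrL lt0n i0/= (leq_ltn_trans _ lin)//.
by rewrite ltnS leq_subr subKn ?(ltnW lin)// => <-.
Qed.


Lemma coef_fiber a f i : (fiber a f)`_i = (f`_i).[a].
Proof. by rewrite coef_map. Qed.

Lemma horner_fiber a b f : (fiber a f).[b] = f.[b%:P].[a].
Proof. by rewrite -[RHS]horner_evalE -horner_map/= horner_evalE hornerC. Qed.

Lemma fiber_inj f g : (forall a, a != 0 -> fiber a f = fiber a g) -> f = g.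
Proof.
move=> fg; apply/polyP => i; apply: poly_eq_punctured => a a0.
by rewrite -!coef_fiber fg.
Qed.

Lemma size_fiber a f : (size (fiber a f) <= size f)%N.
Proof. exact: size_poly. Qed.

Lemma size_fiber_monic a f : f \is monic -> size (fiber a f) = size f.
Proof. by move=> fm; rewrite size_map_poly_id0// (monicP fm)/= horner_evalE hornerC
  oner_eq0. Qed.

Lemma dvdp_small (p q : {poly K}) : (size q < size p)%N -> p %| q -> q = 0.
Proof.
move=> qp pq; apply/eqP/negPn/negP => q0.
by have := dvdp_leq q0 pq; rewrite leqNgt qp.
Qed.

Lemma monic_remainder (A : comNzRingType) (P f : {poly A}) : P \is monic ->
  exists2 r : {poly A}, (size r < size P)%N & in_ideal P (f - r).
Proof.
move=> Pm; exists (Pdiv.Ring.rmodp f P).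
  by rewrite Pdiv.Ring.ltn_rmodp monic_neq0.
exists (Pdiv.Ring.rdivp f P); rewrite {1}(Pdiv.RingMonic.rdivp_eq Pm f).
by rewrite addrK.
Qed.
End Laurent.

Lemma coef_comp_scale (A : comNzRingType) (c : A) (p : {poly A}) i :
  (p \Po (c *: 'X))`_i = c ^+ i * p`_i.
Proof.
rewrite comp_polyE coef_sum (eq_bigr (fun j : 'I_(size p) =>
    if i == j :> nat then c ^+ i * p`_i else 0)); last first.
  move=> j _; rewrite exprZn !coefZ coefXn.
  by case: eqP => [->|]; rewrite ?mulr1 ?mulr0// mulrC.
have [ip|pi] := ltnP i (size p).
  rewrite -big_mkcond (bigD1 (Ordinal ip))//= big1 ?addr0// => j /andP[/eqP ij].
  by rewrite -val_eqE/= -ij eqxx.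
rewrite (nth_default _ pi) mulr0 big1// => j _.
by case: eqP => // ij; move: (ltn_ord j); rewrite -ij ltnNge pi.
Qed.

(** Restriction to a point of the overlap: w goes to 1/a, then zeta to a, which leaves a polynomial
    in the fibre coordinate m. *)
Local Notation fiber01 a :=
  (map_poly (horner_eval a \o horner_eval (a^-1)%:P)).

(** * Ideal membership tested on fibres *)

Section Ideals.
Variable K : numFieldType.
Local Notation poly3 := {poly {poly {poly K}}}.
Implicit Types (P f g : {poly {poly K}}) (F G : poly3) (a b : K).

(** As [P] is monic, the remainder of f has smaller degree than [P] in every fibre, so divisibility
    kills it there; a polynomial that vanishes in all fibres over a <> 0 is zero. *)
Lemma in_idealP P f : P \is monic ->
  in_ideal P f <-> forall a, a != 0 -> fiber a P %| fiber a f.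
Proof.
move=> Pm; split=> [[q ->] a _|Pf]; first by rewrite rmorphM dvdp_mulIr.
have [r rP [q fq]] := monic_remainder f Pm.
exists q; rewrite -fq; suff -> : r = 0 by rewrite subr0.
apply: fiber_inj => a a0; rewrite rmorph0.
apply: (@dvdp_small _ (fiber a P)).
  by rewrite (size_fiber_monic _ Pm); apply: leq_ltn_trans rP; apply: size_fiber.
have -> : r = f - q * P by rewrite -fq subKr.
by rewrite rmorphB dvdp_sub ?Pf// rmorphM dvdp_mulIr.
Qed.

Lemma fiber01_inner a f : fiber01 a (map_poly polyC f) = fiber a f.
Proof.
apply/polyP => i; rewrite coef_map coef_fiber coef_map /=.
by rewrite !horner_evalE hornerC.
Qed.

Local Notation overlap := ('X%:P * 'X - 1 : {poly {poly K}}).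

(** The overlap ring is the localization at zeta: modulo zeta w = 1, a power of zeta cancels every
    w. *)
Lemma clear_w2 (c : {poly {poly K}}) : exists N (p : {poly K}) q,
  'X%:P ^+ N * c - p%:P = q * overlap.
Proof.
elim/poly_ind: c => [|c e [N [p [q E]]]]; first by exists 0%N, 0, 0; rewrite expr0;
  ring.
exists N.+1, (p + 'X ^+ N.+1 * e), ('X%:P ^+ N * c + q).
rewrite mulrDl -E rmorphD rmorphM rmorphXn/= exprS; ring.
Qed.

Lemma clear_w F : exists N (f : {poly {poly K}}) (q : poly3),
  'X%:P%:P ^+ N * F - map_poly polyC f = q * overlap%:P.
Proof.
elim/poly_ind: F => [|F c [N [f [q E]]]].
  by exists 0%N, 0, 0; rewrite rmorph0; ring.
have [M [p [r E2]]] := clear_w2 c.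
(* N clears the higher coefficients and M the new constant one; each part receives the power of zeta
   needed by the other. *)
exists (N + M)%N, (('X ^+ M)%:P * f * 'X + ('X ^+ N * p)%:P),
  ('X%:P%:P ^+ M * q * 'X + 'X%:P%:P ^+ N * r%:P).
have {}E2 : 'X%:P%:P ^+ M * c%:P - p%:P%:P = r%:P * overlap%:P.
  by rewrite -!rmorphM -E2 rmorphB rmorphM rmorphXn.
set RHS := (RHS in _ = RHS).
have -> : RHS = 'X%:P%:P ^+ M * 'X * (q * overlap%:P)
    + 'X%:P%:P ^+ N * (r%:P * overlap%:P) by rewrite /RHS; ring.
rewrite -E -E2 {RHS}.
have -> : map_poly polyC (('X ^+ M)%:P * f * 'X + ('X ^+ N * p)%:P) =
    'X%:P%:P ^+ M * map_poly polyC f * 'X + 'X%:P%:P ^+ N * p%:P%:P.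
  rewrite [LHS]rmorphD/= 2!rmorphM/= map_polyX !map_polyC/=.
  by rewrite !rmorphM !rmorphXn.
rewrite exprD; ring.
Qed.

Lemma fiber01_overlap a : a != 0 -> fiber01 a overlap%:P = 0.
Proof.
move=> a0; rewrite map_polyC/= /horner_eval !hornerE.
by rewrite mulfV ?subrr ?polyC0.
Qed.

(** Clearing w reduces the question to [in_idealP]. Multiplication by w^N then undoes the factor
    zeta^N, because zeta w - 1 divides (zeta w)^N - 1. *)
Lemma in_overlap_idealP P F : P \is monic ->
  (exists q r : poly3, F = q * overlap%:P + r * map_poly polyC P) <->
  forall a, a != 0 -> fiber a P %| fiber01 a F.
Proof.
move=> Pm; split=> [[q [r ->]] a a0|Fa].
  by rewrite rmorphD !rmorphM/= fiber01_overlap// mulr0 add0r fiber01_inner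
    dvdp_mulIr.
have [N [f [q E]]] := clear_w F.
have [r fr] : in_ideal P f.
  apply/(in_idealP f Pm) => a a0; rewrite -(fiber01_inner a f).
  have -> : map_poly polyC f = 'X%:P%:P ^+ N * F - q * overlap%:P.
    by rewrite -E subKr.
  by rewrite rmorphB !rmorphM/= fiber01_overlap// mulr0 subr0 dvdp_mull ?Fa.
pose w : poly3 := 'X%:P; pose z : poly3 := 'X%:P%:P.
have zw : overlap%:P = z * w - 1 by rewrite rmorphB rmorphM.
have [s sE] : exists s : poly3, (z * w) ^+ N - 1 = s * (z * w - 1).
  by rewrite subrX1 mulrC; eexists.
exists (w ^+ N * q - s * F), (w ^+ N * map_poly polyC r).
transitivity (w ^+ N * (z ^+ N * F - map_poly polyC f)
    - ((z * w) ^+ N - 1) * F + w ^+ N * map_poly polyC f).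
  by rewrite exprMn; ring.
by rewrite E sE zw fr rmorphM/=; ring.
Qed.

End Ideals.

Section Fibers.
Variable R : realType.
Local Notation C := (complex R).
Local Notation poly3 := {poly {poly {poly C}}}.
Implicit Types (P f g : {poly {poly C}}) (F G : poly3) (a b u v : C) (S : Defs.cover
  R).

Lemma eval2E f a b : eval2 f a b = (fiber a f).[b].
Proof. exact/esym/horner_fiber. Qed.

Lemma coef_fiber01 a F i : (fiber01 a F)`_i = eval2 (F`_i) a a^-1.
Proof. by rewrite coef_map. Qed.

Lemma coef_act2 u v f j : (act2 u v f)`_j = v ^+ j *: (f`_j \Po (u *: 'X)).
Proof.
by rewrite coef_comp_scale coef_map_id0 ?comp_poly0// -polyC_exp mul_polyC.
Qed.

Lemma coef_coef_act2 u v f i j : (act2 u v f)`_j`_i = v ^+ j * (u ^+ i * f`_j`_i).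
Proof. by rewrite coef_act2 coefZ coef_comp_scale. Qed.

Lemma fiber_act2 a u v f : fiber a (act2 u v f) = fiber (u * a) f \Po (v *: 'X).
Proof.
apply/polyP => j; rewrite coef_comp_scale !coef_fiber coef_act2 hornerZ.
by rewrite horner_comp hornerZ hornerX.
Qed.

Lemma eval2_act2 u v f a b : eval2 (act2 u v f) a b = eval2 f (u * a) (v * b).
Proof. by rewrite !eval2E fiber_act2 horner_comp hornerZ hornerX. Qed.

Lemma fiber01_res0 a f : fiber01 a (res0 f) = fiber a f.
Proof. exact: fiber01_inner. Qed.

Lemma fiber01_resinf S a g :
  fiber01 a (resinf S g) = fiber a^-1 g \Po (a^-1 ^+ (halfdeg S).*2 *: 'X).
Proof.
apply/polyP => i; rewrite coef_fiber01 !coef_comp_scale coef_fiber coef_map/=.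
rewrite /eval2 hornerM horner_exp hornerXn hornerM -polyC_exp.
by rewrite -polyC_exp hornerC horner_map/= hornerC.
Qed.

Lemma fiber01_act3 S a F : fiber01 a (act3 S F) =
  fiber01 (epsilon R * a) F \Po (epsilon R ^+ halfdeg S *: 'X).
Proof.
apply/polyP => i; rewrite coef_fiber01 !coef_comp_scale coef_fiber01.
rewrite coef_map_id0; last first.
  by rewrite /act2 rmorph0 comp_poly0.
rewrite -!polyC_exp {1}/eval2 hornerM hornerC hornerM hornerC; congr (_ * _).
by rewrite -/(eval2 _ _ _) eval2_act2 invfM.
Qed.

Lemma in_ideal01P S F : eq0 S \is monic ->
  in_ideal01 S F <-> forall a, a != 0 -> fiber a (eq0 S) %| fiber01 a F.
Proof. exact: in_overlap_idealP. Qed.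
End Fibers.

(** * Laurent normal forms *)

Section NormalForms.
Variable K : numFieldType.
Local Notation poly3 := {poly {poly {poly K}}}.
Implicit Types (P f g : {poly {poly K}}) (F G : poly3) (a b : K).

(** If r is the remainder of zeta^N F, cutting each coefficient of r at degree N splits zeta^-N r
    into a part in zeta and a part in 1/zeta. Constants go to the first part, which makes the
    splitting unique. *)
Lemma laurent_normal_form P F n : P \is monic -> size P = n.+1 ->
  exists p h : nat -> {poly K}, (forall j, (h j)`_0 = 0) /\
    forall a, a != 0 -> fiber a P %|
      fiber01 a F - \poly_(j < n) ((p j).[a] + (h j).[a^-1]).
Proof.
move=> Pm sP; have [N [f [q E]]] := clear_w F.
have [r rP fr] := monic_remainder f Pm.
exists (fun j => drop_poly N r`_j), (fun j => rev_poly N (take_poly N r`_j)).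
split=> [j|a a0]; first by rewrite coef_poly subn0 coef_take_poly ltnn.
have aN : a ^+ N != 0 by rewrite expf_neq0.
have -> : \poly_(j < n) ((drop_poly N r`_j).[a]
    + (rev_poly N (take_poly N r`_j)).[a^-1]) = (a ^+ N)^-1 *: fiber a r.
  apply/polyP => j; rewrite coef_poly coefZ coef_fiber.
  case: ltnP => jn; last first.
    rewrite nth_default ?horner0 ?mulr0//.
    by move: rP; rewrite sP ltnS => /leq_trans; apply.
  rewrite horner_rev_poly ?invr_neq0//; last first.
    by rewrite (leq_trans (size_take_poly _ _)).
  rewrite invrK exprVn -{3}(poly_take_drop N r`_j) hornerD hornerM hornerXn.
  by rewrite mulrDr mulrCA mulVf// mulr1 addrC.
have {E} E : a ^+ N *: fiber01 a F - fiber a f = 0.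
  have := congr1 (fiber01 a) E.
  rewrite rmorphB [RHS]rmorphM/= fiber01_overlap// mulr0 fiber01_inner.
  rewrite rmorphM rmorphXn/= map_polyC/= /horner_eval !hornerE.
  by rewrite -polyC_exp mul_polyC.
have -> : fiber01 a F - (a ^+ N)^-1 *: fiber a r
    = (a ^+ N)^-1 *: fiber a (f - r).
  apply: (scalerI aN); rewrite scalerBr !scalerA mulfV// !scale1r rmorphB/=.
  by move/eqP: E; rewrite subr_eq0 => /eqP ->.
by rewrite dvdpZr ?invr_neq0//; move/(in_idealP _ Pm): fr; exact.
Qed.

Lemma coef0_comp_scale (c : K) (p : {poly K}) : (p \Po (c *: 'X))`_0 = p`_0.
Proof. by rewrite coef_comp_scale mul1r. Qed.

(** The normal form has smaller fibre degree than [P], so invariance modulo [P] becomes an equality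
    of normal forms, and [laurent_eq] separates the part in zeta from the polar part. *)
Lemma invariant_normal_form P F n (e : K) (p h : nat -> {poly K}) :
  P \is monic -> size P = n.+1 -> e != 0 ->
  (forall a, fiber (e * a) P \Po (e *: 'X) = fiber a P) ->
  (forall j, (h j)`_0 = 0) ->
  (forall a, a != 0 -> fiber a P %|
     fiber01 a F - \poly_(j < n) ((p j).[a] + (h j).[a^-1])) ->
  (forall a, a != 0 ->
     fiber a P %| fiber01 (e * a) F \Po (e *: 'X) - fiber01 a F) ->
  forall j, (j < n)%N ->
    e ^+ j *: (p j \Po (e *: 'X)) = p j /\
    e ^+ j *: (h j \Po (e^-1 *: 'X)) = h j.
Proof.
move=> Pm sP e0 Pe h0 FP Fe j jn.
pose NF a := \poly_(j < n) ((p j).[a] + (h j).[a^-1]).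
have NFe a : a != 0 -> NF (e * a) \Po (e *: 'X) = NF a.
  move=> a0; apply/eqP; rewrite -subr_eq0; apply/eqP.
  apply: (@dvdp_small _ (fiber a P)).
    rewrite size_fiber_monic// sP ltnS (leq_trans (size_polyD _ _))// geq_max.
    rewrite size_polyN size_poly andbT.
    apply/leq_sizeP => i ni; rewrite coef_comp_scale coef_poly.
    by rewrite ltnNge ni mulr0.
  have ea0 : e * a != 0 by rewrite mulf_neq0.
  have /(dvdp_comp_poly (e *: 'X)) := FP _ ea0; rewrite Pe comp_polyB => d1.
  (* Between the two normal forms stand [fiber01 a F] and its transform; each of the three
     differences is a multiple of [fiber a P]. *)
  have alg (x y z t : {poly K}) : x - y = (z - y) + (t - z) - (t - x) by ring.
  rewrite (alg _ _ (fiber01 a F) (fiber01 (e * a) F \Po (e *: 'X))).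
  by rewrite dvdp_sub// dvdp_add ?FP ?Fe.
have [pE hE] : e ^+ j *: (p j \Po (e *: 'X)) - p j = 0 /\
    h j - e ^+ j *: (h j \Po (e^-1 *: 'X)) = 0.
  have := @laurent_eq _ (e ^+ j *: (p j \Po (e *: 'X)) - p j)
    (h j - e ^+ j *: (h j \Po (e^-1 *: 'X))).
  rewrite coefB coefZ coef0_comp_scale h0 mulr0 subr0; apply=> a a0.
  have /polyP/(_ j) := NFe a a0.
  rewrite coef_comp_scale !coef_poly jn !hornerE.
  rewrite !horner_comp !hornerE invfM mulrDr => E.
  have alg (x y z t : K) : x + y = z + t -> x - z = t - y.
    by move=> xy; rewrite -(addrK y x) xy; ring.
  exact: alg E.
by split; apply/eqP; rewrite -subr_eq0 ?pE// -opprB hE oppr0.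
Qed.

(** After f and g are replaced by their remainders, the coboundary relation reads r_j(zeta) =
    R_j(1/zeta) + zeta^(-D j) s_j(1/zeta), and [laurent_eq] makes both sides constant. The case R =
    0 serves H^0, a polar R the independence of the classes in H^1. *)
Lemma cech_remainders P Q f g n D (R : nat -> {poly K}) :
  P \is monic -> size P = n.+1 -> Q \is monic -> size Q = n.+1 ->
  (forall a, a != 0 -> fiber a P %| fiber a^-1 Q \Po (a^-1 ^+ D *: 'X)) ->
  (forall a, a != 0 -> fiber a P %| \poly_(j < n) (R j).[a^-1]
     - (fiber a f - (fiber a^-1 g \Po (a^-1 ^+ D *: 'X)))) ->
  exists (r s : {poly {poly K}}) (c : nat -> K),
  [/\ in_ideal P (f - r), in_ideal Q (g - s), (size r <= n)%N, (size s <= n)%N &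
    forall j, (j < n)%N ->
      r`_j = (c j)%:P /\ R j + 'X^(D * j) * s`_j = (c j)%:P].
Proof.
move=> Pm sP Qm sQ PQ FP.
have [r rP fr] := monic_remainder f Pm; have [s sQ' gs] := monic_remainder g Qm.
rewrite sP ltnS in rP; rewrite sQ ltnS in sQ'.
exists r, s, (fun j => (R j + 'X^(D * j) * s`_j)`_0); split=> // j jn.
apply: laurent_eq => a a0; set h := R j + _.
pose T := \poly_(j < n) (R j).[a^-1].
pose c := a^-1 ^+ D *: 'X : {poly K}.
have : T - (fiber a r - (fiber a^-1 s \Po c)) = 0.
  apply: (@dvdp_small _ (fiber a P)).
    rewrite size_fiber_monic// sP ltnS.
    apply/leq_sizeP => i ni; rewrite !coefB coef_comp_scale [T`_i]coef_poly.
    rewrite ltnNge ni !coef_fiber !nth_default ?(leq_trans _ ni)//.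
    by rewrite !horner0 mulr0 !subr0.
  have alg (t x y x' y' : {poly K}) :
    t - (x - y) = (t - (x' - y')) + (x' - x) - (y' - y) by ring.
  rewrite (alg _ _ _ (fiber a f) (fiber a^-1 g \Po c)) -rmorphB -comp_polyB -rmorphB.
  rewrite -addrA dvdp_add ?FP// dvdp_sub//; first by move/(in_idealP _ Pm): fr; exact.
  rewrite (dvdp_trans (PQ _ a0))// dvdp_comp_poly//.
  by move/(in_idealP _ Qm): gs; apply; rewrite invr_eq0.
move/polyP/(_ j); rewrite coef0 !coefB coef_comp_scale [T`_j]coef_poly jn.
rewrite !coef_fiber /h !hornerE -exprM => /eqP.
by rewrite opprB addrA subr_eq0 eq_sym => /eqP ->.
Qed.

Lemma in_ideal_constant P f (b c : K) : P \is monic -> (1 < size P)%N ->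
  in_ideal P (f - b%:P%:P) -> in_ideal P (f - c%:P%:P) -> b = c.
Proof.
move=> Pm sP [q fq] [r fr]; have E : (q - r) * P = (c - b)%:P%:P.
  by rewrite mulrBl -fq -fr !rmorphB/=; ring.
have /eqP : (c - b)%:P = 0 :> {poly K}.
  apply: (@dvdp_small _ (fiber 1 P)).
    by rewrite size_fiber_monic// (leq_ltn_trans _ sP)// size_polyC leq_b1.
  have -> : (c - b)%:P = fiber 1 ((q - r) * P).
    by rewrite E map_polyC/= /horner_eval hornerC.
  by rewrite rmorphM dvdp_mulIr.
by rewrite polyC_eq0 subr_eq0 => /eqP.
Qed.

End NormalForms.

(** * The sixth root of unity *)

Section Epsilon.
Variable R : realType.
Local Notation C := (complex R).
Local Notation e := (epsilon R).

(** The triple angle formula with cos pi = -1 gives (c + 1) (2 c - 1)^2 = 0, and c > 0. *)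
Lemma cos_pi_third : cos (pi / 3) = 2^-1 :> R.
Proof.
set t : R := pi / 3; set c := cos t.
have : cos (t + t + t) = -1 by rewrite -cospi; congr cos; rewrite /t; field.
rewrite !cosD !sinD -/c; have := cos2Dsin2 t; rewrite -/c.
set s := sin t => cs H.
have {}H : (c + 1) * (2 * c - 1) ^+ 2 = 0.
  have s2 : s ^+ 2 = 1 - c ^+ 2 by rewrite -cs; ring.
  have {}H : 4 * c ^+ 3 - 3 * c + 1 = 0.
    transitivity ((c * c - s * s) * c - (s * c + c * s) * s + 1); last first.
      by rewrite H addrC subrr.
    have -> : (c * c - s * s) * c - (s * c + c * s) * s = c ^+ 3 - 3 * c * s ^+ 2 by
      ring.
    by rewrite s2; ring.
  by rewrite -H; ring.
have c0 : 0 < c.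
  apply: cos_gt0_pihalf; have := pi_gt0 R; rewrite /t => p0.
  by apply/andP; split; lra.
move/eqP: H; rewrite mulf_eq0 expf_eq0/= gt_eqF ?ltr_wpDr//= => /eqP H.
by lra.
Qed.

Lemma epsilon_sqr : e ^+ 2 = e - 1.
Proof.
have := cos2Dsin2 (pi / 3 : R); rewrite /epsilon cos_pi_third => H.
rewrite expr2; apply/eqP; rewrite eq_complex/=; apply/andP; split; apply/eqP;
  last by field.
have -> : sin (pi / 3) * sin (pi / 3) = 1 - 2^-1 ^+ 2 :> R by lra.
by field.
Qed.

(** [epsilon_sqr] gives epsilon^3 = -1, so the order divides 6; the real part 1/2 excludes the
    orders 1 and 2, and -1 <> 1 excludes 3. *)
Lemma epsilon_prim : 6.-primitive_root e.
Proof.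
have e3 : e ^+ 3 = -1 by rewrite exprS epsilon_sqr mulrBr -expr2 epsilon_sqr mulr1
  addrAC subrr add0r.
have e6 : e ^+ 6 = 1 by rewrite (exprM e 3 2) e3 sqrrN expr1n.
have [m mp m6] := prim_order_exists (isT : (0 < 6)%N) e6.
have e1 : e != 1.
  apply/eqP => /(congr1 (@complex.Re R))/= /eqP.
  by rewrite cos_pi_third -subr_eq0 => /eqP; lra.
have en n : n \in [:: 1; 2; 3]%N -> e ^+ n != 1.
  rewrite !inE => /or3P[] /eqP->; rewrite ?expr1//.
    rewrite epsilon_sqr subr_eq; apply/eqP => /(congr1 (@complex.Re R))/= /eqP.
    by rewrite cos_pi_third -subr_eq0 => /eqP; lra.
  by rewrite e3 eq_sym -subr_eq0 opprK -(natrD _ 1 1) pnatr_eq0.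
suff <- : m = 6%N by [].
have mn : m \notin [:: 1; 2; 3]%N.
  by apply/negP => /en; rewrite (prim_expr_order mp) eqxx.
have := dvdn_leq (isT : (0 < 6)%N) m6; move: mn m6 (prim_order_gt0 mp).
by case: m {mp} => [|[|[|[|[|[|[|m]]]]]]].
Qed.

Lemma epsilon_neq0 : e != 0.
Proof.
apply/eqP => e0; have := prim_expr_order epsilon_prim.
by rewrite e0 expr0n/= => /eqP; rewrite eq_sym oner_eq0.
Qed.

(** Since d = 1 modulo 6, the symmetry multiplies the fibre coordinate by the same root of unity as
    the base coordinate. *)
Lemma epsilon_exp k : e ^+ (6 * k + 1) = e.
Proof. by rewrite exprD exprM (prim_expr_order epsilon_prim) expr1n mul1r. Qed.
End Epsilon.

(* w^s m^j with 0 < j < 6, 0 < s < 2 d j and s = j modulo 6, where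
   d = 6 k + 1: then s = j + 6 t with t <= 2 k j. *)
Definition genus_index (k : nat) := {j : 'I_5 & 'I_(2 * k * j.+1).+1}.

Section GenusIndex.
Variable k : nat.
Local Notation I := (genus_index k).

Definition fiber_exp (x : I) : nat := (tag x).+1.
Definition base_exp (x : I) : nat := (tag x).+1 + 6 * tagged x.

(** The sum of 2 k j + 1 over j = 1, ..., 5 is 30 k + 5. *)
Lemma card_genus_index : #|{: I}| = (5 * (6 * k + 1))%N.
Proof.
rewrite card_tagged sumnE big_map big_enum/=.
under eq_bigr do rewrite card_ord.
by rewrite !big_ord_recr big_ord0/=; lia.
Qed.

Lemma fiber_exp_bounds x : (0 < fiber_exp x < 6)%N.
Proof. by rewrite /fiber_exp/= ltnS ltn_ord. Qed.

Lemma base_exp_bounds x : (0 < base_exp x < (6 * k + 1).*2 * fiber_exp x)%N.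
Proof.
rewrite /base_exp /fiber_exp; case: x => j t /=.
by have := ltn_ord t; rewrite -muln2; nia.
Qed.

Lemma base_exp_mod x : base_exp x = fiber_exp x %[mod 6].
Proof. by rewrite /base_exp addnC mulnC modnMDl. Qed.

Lemma exponents_inj x y :
  fiber_exp x = fiber_exp y -> base_exp x = base_exp y -> x = y.
Proof.
case: x y => [i s] [j t]; rewrite /base_exp /fiber_exp/= => -[/val_inj ij].
case: j / ij t => t /eqP; rewrite eqn_add2l eqn_mul2l/= => /eqP/val_inj.
by move=> ->.
Qed.

Lemma exponents_surj j s : (j < 6)%N -> (0 < s < (6 * k + 1).*2 * j)%N ->
  s = j %[mod 6] -> exists x, fiber_exp x = j /\ base_exp x = s.
Proof.
move=> j6 /andP[s0 sj] sj6; have j0 : (0 < j)%N by case: (j) sj; rewrite ?muln0.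
have i5 : (j.-1 < 5)%N by lia.
have tj : ((s - j) %/ 6 < (2 * k * (Ordinal i5).+1).+1)%N.
  by rewrite /= prednK//; move: sj; rewrite -muln2; nia.
by exists (existT _ (Ordinal i5) (Ordinal tj));
  rewrite /base_exp /fiber_exp/= prednK//; lia.
Qed.

Variable K : numFieldType.
Implicit Types (c : I -> K) (h : nat -> {poly K}).

Definition polar_part c j : {poly K} :=
  \sum_(x | fiber_exp x == j) c x *: 'X^(base_exp x).

Lemma coef_polar_part c x : (polar_part c (fiber_exp x))`_(base_exp x) = c x.
Proof.
rewrite coef_sum (bigD1 x)//= coefZ coefXn eqxx mulr1 big1 ?addr0// => y.
case/andP=> /eqP xy yx; rewrite coefZ coefXn.
case: eqP => [xy'|_]; last by rewrite mulr0.
by rewrite (exponents_inj xy (esym xy')) eqxx in yx.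
Qed.

(** The cut at 2 d j is where poles stop mattering: w^s m^j = w^(s - 2 d j) n^j is regular in the
    second chart once s is at least 2 d j. *)
Lemma polar_part_coef h j : (j < 6)%N -> (h j)`_0 = 0 ->
  (forall s, (h j)`_s != 0 -> s = j %[mod 6]) ->
  polar_part (fun x => (h (fiber_exp x))`_(base_exp x)) j
  = take_poly ((6 * k + 1).*2 * j) (h j).
Proof.
move=> j6 h0 hj; apply/polyP => s; rewrite coef_take_poly.
have [sj|/negP sj] := boolP ((s < (6 * k + 1).*2 * j)%N && ((h j)`_s != 0)).
  case/andP: sj => sj hs; rewrite sj.
  have s0 : (0 < s)%N by case: (s) hs => //; rewrite h0 eqxx.
  have [|x [<- <-]] := exponents_surj j6 _ (hj _ hs); first by rewrite s0.
  by rewrite coef_polar_part.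
have -> : (if (s < (6 * k + 1).*2 * j)%N then (h j)`_s else 0) = 0.
  by case: ifP => // s1; apply/eqP/negPn/negP => s2; apply: sj; rewrite s1.
rewrite coef_sum big1// => x /eqP xj; rewrite coefZ coefXn.
case: eqP => [sx|_]; last by rewrite mulr0.
rewrite mulr1; apply/eqP/negPn/negP => hx; apply: sj.
rewrite xj in hx; rewrite sx hx andbT -{1}xj.
by have /andP[_] := base_exp_bounds x.
Qed.

Definition polar_monomial x : {poly {poly {poly K}}} :=
  ('X ^+ base_exp x)%:P * 'X ^+ fiber_exp x.

Lemma fiber01_polar c a :
  fiber01 a (\sum_x (c x)%:P%:P%:P * polar_monomial x) =
  \poly_(j < 6) (polar_part c j).[a^-1].
Proof.
have E x : fiber01 a ((c x)%:P%:P%:P * polar_monomial x) =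
    (c x * a^-1 ^+ base_exp x) *: 'X^(fiber_exp x).
  rewrite /polar_monomial !rmorphM/= map_polyC/= map_polyC/= map_polyXn/=
    /horner_eval.
  by rewrite !hornerC !hornerXn -polyC_exp hornerC mulrA -polyCM mul_polyC.
rewrite rmorph_sum/=; apply/polyP => j; rewrite coef_poly coef_sum.
rewrite (eq_bigr (fun x => if fiber_exp x == j then c x * a^-1 ^+ base_exp x else 0)).
  rewrite -big_mkcond; case: ltnP => j6.
    by rewrite horner_sum; apply: eq_bigr => x _; rewrite hornerZ hornerXn.
  rewrite big_pred0// => x; apply/eqP => xj.
  by have := fiber_exp_bounds x; rewrite xj => /andP[_]; rewrite ltnNge j6.
move=> x _; rewrite E coefZ coefXn eq_sym.
by case: eqP => _; rewrite ?mulr1 ?mulr0.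
Qed.

End GenusIndex.

(** * Cohomology of the quotient *)

Section Genus.
Variables (R : realType) (k : nat) (S : Defs.cover R).
Local Notation C := (complex R).
Local Notation poly3 := {poly {poly {poly C}}}.
Local Notation e := (epsilon R).
Local Notation d := (6 * k + 1)%N.
Local Notation P := (eq0 S).
Local Notation Q := (eqinf S).

Hypothesis halfdegS : halfdeg S = d.
Hypotheses (P_monic : P \is monic) (size_P : size P = 7%N).
Hypotheses (Q_monic : Q \is monic) (size_Q : size Q = 7%N).
Hypothesis P_inv : forall a, fiber (e * a) P \Po (e *: 'X) = fiber a P.
Hypothesis PQ : forall a, a != 0 ->
  fiber a P %| fiber a^-1 Q \Po (a^-1 ^+ d.*2 *: 'X).

Lemma overlap_differenceP F f g :
  in_ideal01 S (F - (res0 f - resinf S g)) <->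
  forall a, a != 0 -> fiber a P %| fiber01 a F
    - (fiber a f - (fiber a^-1 g \Po (a^-1 ^+ d.*2 *: 'X))).
Proof.
split=> [/(in_ideal01P _ P_monic) FP|FP].
  move=> a a0; have := FP a a0.
  by rewrite 2!rmorphB/= fiber01_res0 fiber01_resinf halfdegS.
apply/(in_ideal01P _ P_monic) => a a0; have := FP a a0.
by rewrite 2!rmorphB/= fiber01_res0 fiber01_resinf halfdegS.
Qed.

Lemma in_ideal01B F G : in_ideal01 S F -> in_ideal01 S G -> in_ideal01 S (F - G).
Proof.
move=> [q [r ->]] [q' [r' ->]]; exists (q - q'), (r - r').
by rewrite !mulrBl opprD addrACA.
Qed.

Lemma cover_h0 : h0_eq1 S.
Proof.
move=> f g _ _ fg.
have FP a : a != 0 -> fiber a P %| \poly_(j < 6) (0 : {poly C}).[a^-1]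
    - (fiber a f - (fiber a^-1 g \Po (a^-1 ^+ d.*2 *: 'X))).
  move=> a0; have /(in_ideal01P _ P_monic)/(_ a a0) := fg.
  rewrite rmorphB/= fiber01_res0 fiber01_resinf halfdegS => FP.
  have -> : \poly_(j < 6) (0 : {poly C}).[a^-1] = 0.
    by apply/polyP => j; rewrite coef_poly horner0 if_same coef0.
  by rewrite sub0r dvdpNr.
have [r [s [c [fr gs rs ss rsE]]]] :=
  @cech_remainders _ P Q f g 6 d.*2 (fun=> 0) P_monic size_P Q_monic size_Q PQ FP.
(* For j > 0 the factor X^(2 d j) leaves no constant term, so only the coefficient of m^0 can
   survive. *)
have c0 j : (0 < j < 6)%N -> c j = 0.
  case/andP=> j0 j6; have [_ /polyP/(_ 0%N)] := rsE j j6.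
  by rewrite add0r coefXnM coefC muln_gt0 j0 double_gt0 addn1.
have [rc sc] : r = (c 0%N)%:P%:P /\ s = (c 0%N)%:P%:P.
  split; apply/polyP => j; rewrite coefC.
    case: eqP => [->|/eqP j0]; first by have [] := rsE 0%N isT.
    have [j6|j6] := ltnP j 6; last by rewrite nth_default// (leq_trans rs).
    by have [-> _] := rsE j j6; rewrite c0// lt0n j0.
  case: eqP => [->|/eqP j0].
    by have [_] := rsE 0%N isT; rewrite muln0 mul1r add0r.
  have [j6|j6] := ltnP j 6; last by rewrite nth_default// (leq_trans ss).
  have [_] := rsE j j6; rewrite c0 ?lt0n ?j0// add0r polyC0 => /eqP.
  by rewrite mulf_eq0 -size_poly_eq0 size_polyXn/= => /eqP.
exists (c 0%N).
split; first by split; [rewrite -rc|rewrite -sc].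
have sP : (1 < size P)%N by rewrite size_P.
rewrite rc in fr => b [fb _].
exact: (@in_ideal_constant C P f (c 0%N) b P_monic sP fr fb).
Qed.

Lemma polar_inv01 (x : genus_index k) : inv01 S (polar_monomial C x : poly3).
Proof.
apply/(in_ideal01P _ P_monic) => a a0.
rewrite rmorphB/= fiber01_act3 halfdegS epsilon_exp.
have E b : fiber01 b (polar_monomial C x) = b^-1 ^+ base_exp x *: 'X^(fiber_exp x).
  rewrite rmorphM/= map_polyC/= map_polyXn/= /horner_eval.
  by rewrite hornerXn -polyC_exp hornerC mul_polyC.
rewrite !E comp_polyZ comp_Xn_poly exprZn scalerA invfM exprMn !exprVn mulrAC.
have -> : e ^+ base_exp x = e ^+ fiber_exp x.
  apply/eqP; rewrite (eq_prim_root_expr (epsilon_prim R)).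
  by rewrite base_exp_mod.
by rewrite mulVf ?mul1r ?subrr ?dvdp0// expf_neq0// epsilon_neq0.
Qed.

(** In the relation of [cech_remainders], the coefficient at w^s sees neither the constant, as s >
    0, nor the contribution of the second chart, as s < 2 d j. *)
Lemma polar_free (c : genus_index k -> C) f g :
  in_ideal01 S (\sum_x (c x)%:P%:P%:P * polar_monomial C x - (res0 f - resinf S g)) ->
  forall x, c x = 0.
Proof.
move=> /overlap_differenceP FP x; have {}FP a : a != 0 ->
    fiber a P %| \poly_(j < 6) (polar_part c j).[a^-1]
      - (fiber a f - (fiber a^-1 g \Po (a^-1 ^+ d.*2 *: 'X))).
  by move=> a0; rewrite -fiber01_polar; apply: FP.
have [r [s [b [_ _ _ _ rsE]]]] :=
  @cech_remainders _ P Q f g 6 d.*2 (polar_part c) P_monic size_P Q_monic size_Q PQ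
    FP.
have /andP[_ x6] := fiber_exp_bounds x; have [_] := rsE _ x6.
move=> /polyP/(_ (base_exp x)); rewrite coefD coef_polar_part coefXnM coefC.
by have /andP[x0 ->] := base_exp_bounds x; rewrite addr0 eqn0Ngt x0.
Qed.

(** The part p of the normal form is regular in the first chart, the part of h of order at least 2 d
    j in the second; what lies between is a combination of the polar monomials. *)
Lemma polar_span F : inv01 S F -> exists c : genus_index k -> C,
  coboundary S (F - \sum_x (c x)%:P%:P%:P * polar_monomial C x).
Proof.
move=> /(in_ideal01P _ P_monic) Finv.
have {}Finv a : a != 0 -> fiber a P %| fiber01 (e * a) F \Po (e *: 'X) - fiber01 a F.
  move=> a0; have := Finv a a0.
  by rewrite rmorphB/= fiber01_act3 halfdegS epsilon_exp.
have [p [h [h0 FP]]] := laurent_normal_form F P_monic size_P.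
have ph := invariant_normal_form P_monic size_P (epsilon_neq0 R) P_inv h0 FP Finv.
(* Invariance of w^s m^j amounts to epsilon^(j - s) = 1. *)
have h_mod j : (j < 6)%N -> forall s, (h j)`_s != 0 -> s = j %[mod 6].
  move=> j6 s hs; have [_ /polyP/(_ s)] := ph j j6.
  rewrite coefZ coef_comp_scale mulrA => /eqP.
  rewrite -subr_eq0 -[X in _ - X]mul1r -mulrBl mulf_eq0 (negPf hs) orbF subr_eq0.
  rewrite exprVn eq_sym -(inj_eq (mulIf (expf_neq0 s (epsilon_neq0 R)))) mul1r.
  rewrite divfK ?expf_neq0 ?epsilon_neq0//.
  by rewrite (eq_prim_root_expr (epsilon_prim R)) => /eqP.
pose q j := drop_poly (d.*2 * j) (h j).
exists (fun x => (h (fiber_exp x))`_(base_exp x)).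
(* The sign compensates the minus in the Cech difference. *)
exists (\poly_(j < 6) p j), (- \poly_(j < 6) q j); split.
- apply/(in_idealP _ P_monic) => a a0.
  rewrite rmorphB/= fiber_act2 halfdegS epsilon_exp.
  suff -> : fiber (e * a) (\poly_(j < 6) p j) \Po (e *: 'X) =
      fiber a (\poly_(j < 6) p j) by rewrite subrr dvdp0.
  apply/polyP => j; rewrite coef_comp_scale !coef_fiber !coef_poly.
  case: ifP => j6; last by rewrite !horner0 mulr0.
  have [{2}<- _] := ph j j6.
  by rewrite hornerZ horner_comp hornerZ hornerX.
- apply/(in_idealP _ Q_monic) => a a0.
  rewrite rmorphB/= fiber_act2 halfdegS epsilon_exp.
  suff -> : fiber (e^-1 * a) (- \poly_(j < 6) q j) \Po (e^-1 *: 'X) =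
      fiber a (- \poly_(j < 6) q j) by rewrite subrr dvdp0.
  apply/polyP => j; rewrite coef_comp_scale !coef_fiber !coefN !coef_poly.
  case: ifP => j6; last by rewrite !oppr0 !horner0 mulr0.
  rewrite !hornerN mulrN; congr (- _).
  have -> : e^-1 ^+ j * (q j).[e^-1 * a] = (e^-1 ^+ j *: (q j \Po (e^-1 *: 'X))).[a].
    by rewrite hornerZ horner_comp hornerZ hornerX.
  congr (_.[_]); apply/polyP => s; rewrite coefZ coef_comp_scale !coef_drop_poly.
  apply/eqP; case: (eqVneq (h j)`_(s + d.*2 * j) 0) => [->|hs].
    by rewrite !mulr0.
  have := h_mod _ j6 _ hs; rewrite mulrA -exprD => hj.
  (* From s + 2 d j = j and d = 1 modulo 6 it follows that 6 divides j + s. *)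
  suff -> : e^-1 ^+ (j + s) = 1 by rewrite mul1r.
  rewrite exprVn; suff -> : e ^+ (j + s) = 1 by rewrite invr1.
  apply/eqP; rewrite -(prim_order_dvd (epsilon_prim R)); move: hj; clear.
  by rewrite -muln2; lia.
apply/overlap_differenceP => a a0.
rewrite rmorphB/= fiber01_polar.
have -> : fiber01 a F - \poly_(j < 6) (polar_part (fun x : genus_index k => (h
  (fiber_exp x))`_(base_exp x)) j).[a^-1]
   - (fiber a (\poly_(j < 6) p j) - (fiber a^-1 (- \poly_(j < 6) q j) \Po (a^-1 ^+
     d.*2 *: 'X)))
   = fiber01 a F - \poly_(j < 6) ((p j).[a] + (h j).[a^-1]).
  have alg (V : zmodType) (x y z t : V) : y + z = t -> x - y - z = x - t.
    by move=> <-; rewrite opprD addrA.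
  apply: alg.
  apply/polyP => j; rewrite coefD coefB coef_comp_scale.
  rewrite !coef_fiber coefN hornerN mulrN opprK !coef_poly.
  case: ifP => j6; last by rewrite !horner0 mulr0 !addr0.
  rewrite (polar_part_coef k j6 (h0 j) (h_mod j j6)) addrCA; congr (_ + _).
  rewrite -[in RHS](poly_take_drop (d.*2 * j) (h j)) hornerD hornerM hornerXn.
  by rewrite -exprM mulrC.
exact: FP.
Qed.

Theorem cover_genus : has_genus S (5 * (6 * k + 1)).
Proof.
split; first exact: cover_h0.
rewrite -card_genus_index; exists (fun i => polar_monomial C (enum_val i)).
split=> [i|F Finv]; first exact: polar_inv01.
have enumE (c : genus_index k -> C) :
    \sum_(i < #|{: genus_index k}|) (c (enum_val i))%:P%:P%:P * polar_monomial C
      (enum_val i)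
    = \sum_x (c x)%:P%:P%:P * polar_monomial C x :> poly3.
  by rewrite -(big_enum_val (fun x : genus_index k => (c x)%:P%:P%:P * polar_monomial
    C x)).
have [c cF] := polar_span Finv.
exists (\row_i c (enum_val i)); split.
  by under eq_bigr do rewrite mxE; rewrite enumE.
move=> c' [f' [g' [_ _ c'F]]]; case: cF => [f [g [_ _ cF]]].
(* Two coordinate vectors of the same class differ by the coefficients of a coboundary, which
   [polar_free] forces to be zero. *)
pose b x := c' 0 (enum_rank x) - c x.
apply/rowP => i; rewrite mxE; apply/eqP; rewrite eq_sym -subr_eq0.
rewrite -{1}(enum_valK i); apply/eqP.
apply: (@polar_free b (f - f') (g - g')).
have := in_ideal01B cF c'F.
have alg (A : comNzRingType) (F0 s s' x x' y y' : A) : F0 - s - (x - y)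
  - (F0 - s' - (x' - y')) = s' - s - (x - x' - (y - y')) by ring.
rewrite alg -!raddfB/=; congr (in_ideal01 S (_ - _)).
have -> : \sum_(i < #|{: genus_index k}|)
    (c' 0 i)%:P%:P%:P * polar_monomial C (enum_val i) =
    \sum_x (c' 0 (enum_rank x))%:P%:P%:P * polar_monomial C x :> poly3.
  rewrite -(enumE (fun x => c' 0 (enum_rank x))); apply: eq_bigr => l _.
  by rewrite /= enum_valK.
rewrite -sumrB; apply: eq_bigr => x _.
by rewrite -mulrBl -!polyCB.
Qed.

End Genus.

(** * Cotangent spaces of the quotient *)

Local Notation cst c := (c%:P%:P).

Section PartialDerivatives.
Variable K : numFieldType.
Implicit Types (f g : {poly {poly K}}) (a b c : K).

Definition partial_x a b f : K := (f.[b%:P])^`().[a].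
Definition partial_y a b f : K := (fiber a f)^`().[b].

Lemma partial_xD a b f g :
  partial_x a b (f + g) = partial_x a b f + partial_x a b g.
Proof. by rewrite /partial_x hornerD derivD hornerD. Qed.

Lemma partial_xM a b f g : partial_x a b (f * g) =
  partial_x a b f * g.[b%:P].[a] + f.[b%:P].[a] * partial_x a b g.
Proof. by rewrite /partial_x hornerM derivM hornerD !hornerM. Qed.

Lemma partial_xC a b c : partial_x a b (cst c) = 0.
Proof. by rewrite /partial_x hornerC derivC horner0. Qed.

Lemma partial_yD a b f g :
  partial_y a b (f + g) = partial_y a b f + partial_y a b g.
Proof. by rewrite /partial_y rmorphD/= derivD hornerD. Qed.

Lemma partial_yM a b f g : partial_y a b (f * g) =
  partial_y a b f * g.[b%:P].[a] + f.[b%:P].[a] * partial_y a b g.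
Proof. by rewrite /partial_y rmorphM/= derivM hornerD !hornerM !horner_fiber. Qed.

Lemma partial_yC a b c : partial_y a b (cst c) = 0.
Proof. by rewrite /partial_y map_polyC derivC horner0. Qed.

Lemma poly2_monomials f :
  f = \sum_(j < size f) \sum_(i < size f`_j)
        cst ((f`_j)`_i) * ('X%:P ^+ i * 'X ^+ j).
Proof.
rewrite -{1}(coefK f) poly_def; apply: eq_bigr => j _.
rewrite -{1}(coefK f`_j) poly_def -mul_polyC rmorph_sum/= mulr_suml.
apply: eq_bigr => i _.
by rewrite -mul_polyC rmorphM rmorphXn/= mulrA.
Qed.

Lemma in_ideal_small (P f : {poly {poly K}}) : P \is monic ->
  (size f < size P)%N -> in_ideal P f -> f = 0.
Proof.
move=> Pm sf /(in_idealP _ Pm) Pf; apply: fiber_inj => a a0; rewrite rmorph0.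
apply: (@dvdp_small _ (fiber a P)); last exact: Pf.
by rewrite (size_fiber_monic _ Pm); apply: leq_ltn_trans sf; apply: size_fiber.
Qed.

End PartialDerivatives.

Section InIdeal.
Variables (A : comNzRingType) (P : A).

Lemma in_ideal_zero f : in_ideal 0 f -> f = 0 :> A.
Proof. by move=> [q ->]; rewrite mulr0. Qed.

Lemma in_idealD f g : in_ideal P f -> in_ideal P g -> in_ideal P (f + g).
Proof. by move=> [q ->] [r ->]; exists (q + r); rewrite mulrDl. Qed.

Lemma in_idealM f g : in_ideal P g -> in_ideal P (f * g).
Proof. by move=> [q ->]; exists (f * q); rewrite mulrA. Qed.

Lemma in_idealB f g : in_ideal P f -> in_ideal P g -> in_ideal P (f - g).
Proof. by move=> [q ->] [r ->]; exists (q - r); rewrite mulrBl. Qed.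

Lemma in_ideal0 : in_ideal P 0.
Proof. by exists 0; rewrite mul0r. Qed.
End InIdeal.

Section Invariants.
Variable R : realType.
Local Notation C := (complex R).
Local Notation T := {poly {poly C}}.
Variables u v : C.

Lemma act2D (f g : T) : act2 u v (f + g) = act2 u v f + act2 u v g.
Proof. by rewrite /act2 rmorphD/= comp_polyD. Qed.

Lemma act2M (f g : T) : act2 u v (f * g) = act2 u v f * act2 u v g.
Proof. by rewrite /act2 rmorphM/= comp_polyM. Qed.

Lemma act2C (c : C) : act2 u v (cst c) = cst c.
Proof. by rewrite /act2 map_polyC/= !comp_polyC. Qed.

Lemma act2B (f g : T) : act2 u v (f - g) = act2 u v f - act2 u v g.
Proof. by rewrite /act2 rmorphB/= comp_polyB. Qed.

Lemma act2_x : act2 u v 'X%:P = cst u * 'X%:P.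
Proof. by rewrite /act2 map_polyC/= comp_polyX comp_polyC -rmorphM/= mul_polyC. Qed.

Lemma act2_y : act2 u v 'X = cst v * 'X.
Proof. by rewrite /act2 map_polyX comp_polyX mul_polyC. Qed.

Lemma act2X (f : T) n : act2 u v (f ^+ n) = act2 u v f ^+ n.
Proof. by elim: n => [|n IH]; rewrite ?expr0 ?(act2C 1)// !exprS act2M IH. Qed.

Lemma act2_size (f : T) : (size (act2 u v f) <= size f)%N.
Proof.
apply/leq_sizeP => j fj; rewrite coef_act2 nth_default//.
by rewrite comp_poly0 scaler0.
Qed.

Variable P : T.
Local Notation inv := (Defs.invariant P u v).

Lemma invariantD f g : inv f -> inv g -> inv (f + g).
Proof. by move=> fi gi; rewrite /Defs.invariant act2D opprD addrACA;
  apply: in_idealD. Qed.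

Lemma invariantM f g : inv f -> inv g -> inv (f * g).
Proof.
move=> fi gi; rewrite /Defs.invariant act2M.
have alg (A : comNzRingType) (x y z t : A) : x * y - z * t = x * (y - t) + t * (x -
  z).
  by ring.
by rewrite alg; apply: in_idealD; apply: in_idealM.
Qed.

Lemma invariantC c : inv (cst c).
Proof. by rewrite /Defs.invariant act2C subrr; apply: in_ideal0. Qed.

Variables a b : C.
Local Notation m := (max_ideal P u v a b).
Local Notation m2 := (max_ideal_sq P u v a b).

Lemma eval2D (f g : T) : eval2 (f + g) a b = eval2 f a b + eval2 g a b.
Proof. by rewrite /eval2 !hornerD. Qed.

Lemma eval2B (f g : T) : eval2 (f - g) a b = eval2 f a b - eval2 g a b.
Proof. by rewrite /eval2 !hornerD !hornerN. Qed.

Lemma eval2M (f g : T) : eval2 (f * g) a b = eval2 f a b * eval2 g a b.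
Proof. by rewrite /eval2 !hornerM. Qed.

Lemma eval2C c : eval2 (cst c) a b = c.
Proof. by rewrite /eval2 !hornerC. Qed.

Lemma max_idealM f g : inv f -> m g -> m (f * g).
Proof.
by move=> fi [gi g0]; split; [exact: invariantM | rewrite eval2M g0 mulr0].
Qed.

Lemma max_ideal_sub f : inv f -> m (f - cst (eval2 f a b)).
Proof.
move=> fi; split; last by rewrite eval2B eval2C subrr.
by rewrite -polyCN -polyCN; apply: invariantD => //; apply: invariantC.
Qed.

Lemma max_ideal_sq_ideal f : in_ideal P f -> m2 f.
Proof.
by move=> fP; exists 0%N, (fun=> 0), (fun=> 0); split=> [[]//|];
  rewrite big_ord0 subr0.
Qed.

Lemma max_ideal_sqM f g : m f -> m g -> m2 (f * g).
Proof.
move=> fm gm; exists 1%N, (fun=> f), (fun=> g); split=> //.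
by rewrite big_ord1 subrr; apply: in_ideal0.
Qed.

Lemma max_ideal_sqD f g : m2 f -> m2 g -> m2 (f + g).
Proof.
move=> [r [f1 [f2 [fm fE]]]] [s [g1 [g2 [gm gE]]]].
pose glue (x : 'I_r -> T) (y : 'I_s -> T) i :=
  match fintype.split i with inl j => x j | inr j => y j end.
exists (r + s)%N, (glue f1 g1), (glue f2 g2); split.
  by rewrite /glue => i; case: fintype.splitP => j _.
rewrite big_split_ord/= opprD addrACA; apply: in_idealD.
  rewrite (eq_bigr (fun i => f1 i * f2 i))// => i _.
  by rewrite /glue (unsplitK (inl i)).
rewrite (eq_bigr (fun i => g1 i * g2 i))// => i _.
by rewrite /glue (unsplitK (inr i)).
Qed.

Lemma max_ideal_sqMl h f : inv h -> m2 f -> m2 (h * f).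
Proof.
move=> hi [r [f1 [f2 [fm fE]]]]; exists r, (fun i => h * f1 i), f2; split.
  by move=> i; have [f1m f2m] := fm i; split=> //; apply: max_idealM.
under eq_bigr do rewrite -mulrA.
by rewrite -mulr_sumr -mulrBr; apply: in_idealM.
Qed.

Lemma max_ideal_sqZ c f : m2 f -> m2 (cst c * f).
Proof. by apply: max_ideal_sqMl; apply: invariantC. Qed.

Lemma max_ideal_sqB f g : m2 f -> m2 g -> m2 (f - g).
Proof.
move=> fm gm; have -> : f - g = f + cst (-1) * g by rewrite !polyCN mulN1r.
by apply: max_ideal_sqD => //; apply: max_ideal_sqZ.
Qed.

(** Write f = q P + sum f1 f2. By Leibniz the products of functions vanishing at the point have zero
    gradient there, and q P has gradient q(a, b) times that of [P]. This obstructs membership in the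
    square of the maximal ideal. *)
Lemma max_ideal_sq_grad f : eval2 P a b = 0 -> m2 f ->
  exists c, partial_x a b f = c * partial_x a b P /\
            partial_y a b f = c * partial_y a b P.
Proof.
move=> P0 [r [f1 [f2 [fm [q fE]]]]]; exists q.[b%:P].[a].
have -> : f = q * P + \sum_i f1 i * f2 i by rewrite -fE subrK.
(* Both partial derivatives are point derivations, so one argument treats them together. *)
have z (d : T -> C) : d (cst 0) = 0 -> (forall f g, d (f + g) = d f + d g) ->
    (forall f g, d (f * g) = d f * g.[b%:P].[a] + f.[b%:P].[a] * d g) ->
    d (q * P + \sum_i f1 i * f2 i) = q.[b%:P].[a] * d P.
  move=> d0 dD dM; rewrite dD dM.
  have -> : P.[b%:P].[a] = 0 by exact: P0.
  rewrite mulr0 add0r -[RHS]addr0; congr (_ + _).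
  apply: (big_ind (fun h => d h = 0)) => [//|x y dx dy|i _].
    by rewrite dD dx dy addr0.
  have [[_ f10] [_ f20]] := fm i; rewrite dM.
  by rewrite /eval2 in f10 f20; rewrite f10 f20 mulr0 mul0r addr0.
split; apply: z.
- exact: partial_xC.
- exact: partial_xD.
- exact: partial_xM.
- exact: partial_yC.
- exact: partial_yD.
- exact: partial_yM.
Qed.

End Invariants.

(** * Cotangent space of the quotient of the plane, and its restriction to the curve *)

Section SmoothChart.
Variable R : realType.
Local Notation C := (complex R).
Local Notation T := {poly {poly C}}.
Variables (u a b : C).
Hypothesis u_prim : 6.-primitive_root u.
Local Notation ev f := (eval2 f a b).
Local Notation m := (max_ideal 0 u u a b).
Local Notation m2 := (max_ideal_sq 0 u u a b).
Local Notation inv := (Defs.invariant 0 u u).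

Section CotangentSpan.
Variables (s r : T).

Definition cotangent_span (f : T) :=
  exists x y, m2 (f - (cst x * s + cst y * r)).

Lemma cotangent_spanD f g :
  cotangent_span f -> cotangent_span g -> cotangent_span (f + g).
Proof.
move=> [x [y fs]] [x' [y' gs]]; exists (x + x'), (y + y').
have alg (A : comNzRingType) (p q z w z' w' t v : A) :
    p + q - ((z + z') * t + (w + w') * v) =
    (p - (z * t + w * v)) + (q - (z' * t + w' * v)) by ring.
by rewrite !polyCD alg; apply: max_ideal_sqD.
Qed.

Lemma cotangent_spanZ c f : cotangent_span f -> cotangent_span (cst c * f).
Proof.
move=> [x [y fs]]; exists (c * x), (c * y).
have alg (A : comNzRingType) (p c' z w t v : A) :
    c' * p - (c' * z * t + c' * w * v) = c' * (p - (z * t + w * v)) by ring.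
by rewrite !polyCM alg; apply: max_ideal_sqZ.
Qed.

Lemma cotangent_spanB f g :
  cotangent_span f -> cotangent_span g -> cotangent_span (f - g).
Proof.
move=> fs gs; have -> : f - g = f + cst (-1) * g by rewrite !polyCN mulN1r.
by apply: cotangent_spanD => //; apply: cotangent_spanZ.
Qed.

Lemma cotangent_span_sq f : m2 f -> cotangent_span f.
Proof. by move=> fm; exists 0, 0; rewrite !polyC0 !mul0r addr0 subr0. Qed.

Lemma max_ideal_sq0 : m2 0.
Proof. exact/max_ideal_sq_ideal/in_ideal0. Qed.

Lemma cotangent_span_l : cotangent_span s.
Proof.
have E : s - (cst 1 * s + cst 0 * r) = 0 by rewrite polyC0 mul0r addr0 mul1r subrr.
by exists 1, 0; rewrite E; exact: max_ideal_sq0.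
Qed.

Lemma cotangent_span_r : cotangent_span r.
Proof.
have E : r - (cst 0 * s + cst 1 * r) = 0 by rewrite polyC0 mul0r add0r mul1r subrr.
by exists 0, 1; rewrite E; exact: max_ideal_sq0.
Qed.

(** The differential of f at (a, b) lies in the span of s and r; subtracting the value puts an
    invariant f into the maximal ideal. *)
Definition cotangent_class (f : T) := cotangent_span (f - cst (ev f)).

Lemma cotangent_classC c : cotangent_class (cst c).
Proof.
rewrite /cotangent_class eval2C subrr; apply: cotangent_span_sq.
exact/max_ideal_sq_ideal/in_ideal0.
Qed.

Lemma cotangent_classD f g :
  cotangent_class f -> cotangent_class g -> cotangent_class (f + g).
Proof.
move=> fs gs; rewrite /cotangent_class eval2D !polyCD opprD addrACA.
exact: cotangent_spanD.
Qed.

Lemma max_ideal_sq_leibniz f g : inv f -> inv g ->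
  m2 ((f - cst (ev f)) * (g - cst (ev g))).
Proof. by move=> fi gi; apply: max_ideal_sqM; apply: max_ideal_sub. Qed.

(** Leibniz rule: the defect (f - f(a, b)) (g - g(a, b)) is a product of two elements of the maximal
    ideal. *)
Lemma cotangent_classM f g : inv f -> inv g ->
  cotangent_class f -> cotangent_class g -> cotangent_class (f * g).
Proof.
move=> fi gi fs gs; rewrite /cotangent_class eval2M !polyCM.
have alg (A : comNzRingType) (p q x y : A) : p * q - x * y =
    (p - x) * (q - y) + (x * (q - y) + y * (p - x)) by ring.
rewrite alg; apply: cotangent_spanD.
  exact/cotangent_span_sq/max_ideal_sq_leibniz.
by apply: cotangent_spanD; apply: cotangent_spanZ.
Qed.

Lemma cotangent_classX f n : inv f -> cotangent_class f ->
  inv (f ^+ n) /\ cotangent_class (f ^+ n).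
Proof.
move=> fi fs; elim: n => [|n [IHi IHs]].
  by rewrite expr0; split; [exact: (invariantC _ _ _ 1) | exact: (cotangent_classC
    1)].
by rewrite exprS; split; [exact: invariantM | exact: cotangent_classM].
Qed.

(** Quotient rule: df = (d(g f) - f dg) / g at a point where g does not vanish. *)
Lemma cotangent_class_div g f : inv g -> inv f -> ev g != 0 ->
  cotangent_class g -> cotangent_class (g * f) -> cotangent_class f.
Proof.
move=> gi fi g0 gs gfs.
have -> : cotangent_class f =
    cotangent_span (cst (ev g)^-1 * (cst (ev g) * (f - cst (ev f)))).
  by rewrite mulrA -!polyCM mulVf// !polyC1 mul1r.
apply: cotangent_spanZ.
have alg (A : comNzRingType) (p q x y : A) :
    y * (p - x) = (q * p - y * x) - (q - y) * (p - x) - x * (q - y) by ring.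
rewrite (alg _ _ g); apply: cotangent_spanB; last exact: cotangent_spanZ.
apply: cotangent_spanB; last exact/cotangent_span_sq/max_ideal_sq_leibniz.
by move: gfs; rewrite /cotangent_class eval2M !polyCM.
Qed.

(* U^(6 j) (U^i V^j) = (U^5 V)^j (U^6)^((i + j) / 6) *)
Lemma cotangent_class_monomial U V i j :
  act2 u u U = cst u * U -> act2 u u V = cst u * V -> ev U != 0 ->
  cotangent_class (U ^+ 6) -> cotangent_class (U ^+ 5 * V) -> (6 %| i + j)%N ->
  cotangent_class (U ^+ i * V ^+ j).
Proof.
move=> Uu Vu U0 c6 c5 ij.
have mono k l : (6 %| k + l)%N -> inv (U ^+ k * V ^+ l).
  move=> kl; rewrite /Defs.invariant act2M !act2X Uu Vu.
  have alg (A : comNzRingType) (c x y : A) : (c * x) ^+ k * (c * y) ^+ l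
      - x ^+ k * y ^+ l = (c ^+ (k + l) - 1) * (x ^+ k * y ^+ l).
    by rewrite !exprMn exprD; ring.
  rewrite alg -!polyC_exp; move/eqP: kl => kl.
  have -> : u ^+ (k + l) = 1.
    by rewrite (divn_eq (k + l) 6) kl addn0 mulnC exprM (prim_expr_order u_prim)
      expr1n.
  by rewrite subrr mul0r; apply: in_ideal0.
have i6 : inv (U ^+ 6) by have := mono 6%N 0%N isT; rewrite expr0 mulr1.
have i5 : inv (U ^+ 5 * V) by exact: (mono 5%N 1%N isT).
have [g6i g6c] := cotangent_classX j i6 c6.
apply: (cotangent_class_div g6i (mono _ _ ij)) => //.
  rewrite -exprM; have evX n : ev (U ^+ n) = ev U ^+ n.
    by elim: n => [|n IH]; rewrite ?expr0 ?(eval2C _ _ 1)// !exprS eval2M IH.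
  by rewrite evX expf_neq0.
have -> : (U ^+ 6) ^+ j * (U ^+ i * V ^+ j) =
    (U ^+ 5 * V) ^+ j * (U ^+ 6) ^+ ((i + j) %/ 6).
  have alg (A : comNzRingType) (x y : A) n : (6 * n = i + j)%N ->
      (x ^+ 6) ^+ j * (x ^+ i * y ^+ j) = (x ^+ 5 * y) ^+ j * (x ^+ 6) ^+ n.
    move=> nE; rewrite [(_ * y) ^+ j]exprMn -!exprM mulrA -exprD [RHS]mulrAC -exprD.
    by congr (x ^+ _ * _); lia.
  by apply: alg; rewrite mulnC divnK.
have [x5i x5c] := cotangent_classX j i5 c5.
have [x6i x6c] := cotangent_classX ((i + j) %/ 6) i6 c6.
exact: cotangent_classM.
Qed.

Hypothesis monomials : forall i j, (6 %| i + j)%N ->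
  cotangent_class ('X%:P ^+ i * 'X ^+ j).

(** Modulo the zero ideal invariance holds coefficient by coefficient, so only monomials of total
    degree divisible by 6 occur in f. *)
Lemma invariant_cotangent_class f : inv f -> cotangent_class f.
Proof.
move=> /in_ideal_zero/eqP; rewrite subr_eq0 => /eqP fu.
have f_supp i j : (f`_j)`_i != 0 -> (6 %| i + j)%N.
  move=> f0; have := coef_coef_act2 u u f i j; rewrite fu mulrA -exprD => /eqP.
  rewrite -subr_eq0 -{1}[(f`_j)`_i]mul1r -mulrBl mulf_eq0 (negPf f0) orbF subr_eq0.
  by rewrite eq_sym -(prim_order_dvd u_prim) addnC.
rewrite [f]poly2_monomials.
apply: (big_ind cotangent_class) => [||j _]; first exact: (cotangent_classC 0).
  exact: cotangent_classD.
apply: (big_ind cotangent_class) => [||i _]; first exact: (cotangent_classC 0).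
  exact: cotangent_classD.
have [->|f0] := eqVneq (f`_j)`_i 0.
  by rewrite !polyC0 mul0r; exact: (cotangent_classC 0).
have mc := monomials (f_supp _ _ f0).
rewrite /cotangent_class eval2M eval2C !polyCM -mulrBr.
exact: cotangent_spanZ.
Qed.

End CotangentSpan.

Variable P : T.
Hypotheses (P_monic : P \is monic) (P_inv : act2 u u P = P) (P_ab : ev P = 0).
Local Notation mP := (max_ideal P u u a b).
Local Notation mP2 := (max_ideal_sq P u u a b).

Lemma max_ideal_sq_zero f : m2 f -> mP2 f.
Proof.
have iP h : m h -> mP h.
  by move=> [/in_ideal_zero hu h0]; split=> //; rewrite /Defs.invariant hu;
    apply: in_ideal0.
move=> [n [g [h [gh fE]]]]; exists n, g, h; split=> [i|].
  by have [gm hm] := gh i; split; apply: iP.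
by rewrite (in_ideal_zero fE); apply: in_ideal0.
Qed.

(** The action fixes [P] and does not raise the fibre degree, so it maps remainders to remainders.
    The remainder of a function invariant modulo [P] is therefore an invariant polynomial. *)
Lemma max_ideal_reduce f : mP f -> exists2 g, m g & in_ideal P (f - g).
Proof.
move=> [fi f0]; have [g gP fg] := monic_remainder f P_monic.
exists g => //; split; last first.
  have [q E] := fg; have -> : g = f - q * P by rewrite -E subKr.
  by rewrite eval2B eval2M P_ab mulr0 f0 subrr.
rewrite /Defs.invariant; suff -> : act2 u u g - g = 0 by apply: in_ideal0.
apply: (in_ideal_small P_monic).
  apply: leq_ltn_trans gP; rewrite (leq_trans (size_polyD _ _))// geq_max.
  by rewrite size_polyN leqnn act2_size.
have -> : act2 u u g - g = (act2 u u f - f) - (act2 u u (f - g) - (f - g)).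
  have alg (A : comNzRingType) (x y z t : A) : x - y = z - t - (z - x - (t - y)).
    by ring.
  by rewrite act2B; apply: alg.
apply: in_idealB => //; apply: in_idealB => //.
by have [q ->] := fg; rewrite act2M P_inv; apply: in_idealM; exists 1; rewrite mul1r.
Qed.

(** On the curve x s + y r = 0 modulo the square, so r alone spans, as x <> 0. If r were zero there,
    so would be s; the gradients of both would be multiples of that of [P], against the nonzero
    determinant. *)
Lemma smooth_point_core s r x y :
  m s -> m r ->
  (forall f, inv f -> cotangent_class s r f) ->
  partial_x a b s * partial_y a b r != partial_x a b r * partial_y a b s ->
  x != 0 -> m2 (P - (cst x * s + cst y * r)) ->
  exists t, [/\ mP t, ~ mP2 t &
    forall f, mP f -> exists c : C, mP2 (f - c%:P%:P * t)].
Proof.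
move=> ms mr span det x0 /max_ideal_sq_zero Psr.
have mP2P f : in_ideal P f -> mP2 f by apply: max_ideal_sq_ideal.
have rel : mP2 (cst x * s + cst y * r).
  have -> : cst x * s + cst y * r = P - (P - (cst x * s + cst y * r)) by rewrite
    subKr.
  by apply: max_ideal_sqB => //; apply: mP2P; exists 1; rewrite mul1r.
exists r; split.
- by case: mr => /in_ideal_zero rE r0; split=> //; rewrite /Defs.invariant rE;
  apply: in_ideal0.
- move=> rm; have sm : mP2 s.
    have -> : s = cst x^-1 * (cst x * s + cst y * r - cst y * r).
      by rewrite addrK mulrA -!polyCM mulVf// !polyC1 mul1r.
    by apply: max_ideal_sqZ; apply: max_ideal_sqB => //; apply: max_ideal_sqZ.
  have [c [cx cy]] := max_ideal_sq_grad P_ab rm.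
  have [c' [cx' cy']] := max_ideal_sq_grad P_ab sm.
  by move: det; rewrite cx cy cx' cy' => /eqP; apply;
    rewrite mulrACA [RHS]mulrACA [c' * c]mulrC.
move=> f /max_ideal_reduce[g [gi g0] fg].
have [x' [y' gsr]] := span g gi; rewrite g0 !polyC0 subr0 in gsr.
(* Elimination of s from x' s + y' r by means of x s + y r = 0. *)
exists (y' - x' * x^-1 * y).
have -> : f - cst (y' - x' * x^-1 * y) * r =
    (f - g) + ((g - (cst x' * s + cst y' * r))
      + cst (x' * x^-1) * (cst x * s + cst y * r)).
  have alg (A : comNzRingType) (p q z v v' t t' w w' : A) : w' = z * w ->
      p - (v' - z * v) * t' =
      (p - q) + ((q - (w' * t + v' * t')) + z * (w * t + v * t')).
    by move=> ->; ring.
  have -> : cst (y' - x' * x^-1 * y) = cst y' - cst (x' * x^-1) * cst y.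
    by rewrite -!polyCM -!polyCB.
  apply: alg.
  by rewrite -!polyCM mulfVK.
apply: max_ideal_sqD; first exact: mP2P.
apply: max_ideal_sqD; first exact: max_ideal_sq_zero.
exact: max_ideal_sqZ.
Qed.

End SmoothChart.

Section Jacobian.
Variables (K : numFieldType) (a b : K).
Implicit Types (f U V : {poly {poly K}}) (c : K).

Lemma partial_x_subC f c : partial_x a b (f - cst c) = partial_x a b f.
Proof. by rewrite -!polyCN partial_xD partial_xC addr0. Qed.

Lemma partial_y_subC f c : partial_y a b (f - cst c) = partial_y a b f.
Proof. by rewrite -!polyCN partial_yD partial_yC addr0. Qed.

Lemma partial_xX f n : partial_x a b (f ^+ n.+1) =
  n.+1%:R * f.[b%:P].[a] ^+ n * partial_x a b f.
Proof.
elim: n => [|n IH]; first by rewrite expr1 expr0 !mul1r.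
rewrite exprS partial_xM IH !horner_exp -[in RHS]natr1 !exprS; ring.
Qed.

Lemma partial_yX f n : partial_y a b (f ^+ n.+1) =
  n.+1%:R * f.[b%:P].[a] ^+ n * partial_y a b f.
Proof.
elim: n => [|n IH]; first by rewrite expr1 expr0 !mul1r.
rewrite exprS partial_yM IH !horner_exp -[in RHS]natr1 !exprS; ring.
Qed.

Definition jacobian f g :=
  partial_x a b f * partial_y a b g - partial_x a b g * partial_y a b f.

Lemma jacobian_xy : jacobian 'X%:P 'X = 1.
Proof.
rewrite /jacobian /partial_x /partial_y map_polyX map_polyC/= /horner_eval.
by rewrite !hornerX !hornerC !derivX !derivC !horner0 -polyC1 !hornerC mulr1 mulr0
  subr0.
Qed.

Lemma jacobianC f g : jacobian f g = - jacobian g f.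
Proof. by rewrite /jacobian; ring. Qed.

(** The Jacobian of U^6 and U^5 V is 6 U^10 times that of U and V. *)
Lemma jacobian_weight6 U V c c' : U.[b%:P].[a] != 0 -> jacobian U V != 0 ->
  jacobian (U ^+ 6 - cst c) (U ^+ 5 * V - cst c') != 0.
Proof.
move=> U0 UV; rewrite /jacobian !partial_x_subC !partial_y_subC.
rewrite partial_xM partial_yM !partial_xX !partial_yX horner_exp horner_exp.
set x := U.[_].[a] in U0 *.
have -> : 6%:R * x ^+ 5 * partial_x a b U *
  (5%:R * x ^+ 4 * partial_y a b U * V.[b%:P].[a] + x ^+ 5 * partial_y a b V) -
  (5%:R * x ^+ 4 * partial_x a b U * V.[b%:P].[a] + x ^+ 5 * partial_x a b V) *
  (6%:R * x ^+ 5 * partial_y a b U) = 6 * x ^+ 10 * jacobian U V.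
  by rewrite /jacobian; ring.
by rewrite !mulf_neq0 ?expf_neq0// pnatr_eq0.
Qed.

End Jacobian.

(** * Smoothness of the quotient curve where the gradient is nonzero *)

Section SmoothPoint.
Variable R : realType.
Local Notation C := (complex R).
Local Notation T := {poly {poly C}}.
Variables (u a b : C) (P : T).
Hypothesis u_prim : 6.-primitive_root u.
Hypotheses (P_monic : P \is monic) (P_inv : act2 u u P = P).
Hypothesis P_ab : eval2 P a b = 0.
Hypothesis P_grad : partial_x a b P != 0 \/ partial_y a b P != 0.
Local Notation m := (max_ideal 0 u u a b).
Local Notation inv := (Defs.invariant 0 u u).

(** [P] is itself invariant and vanishes at the point, hence equals x s + y r modulo the square; a
    nonzero gradient gives (x, y) <> (0, 0), and s and r may be exchanged. *)
Lemma smooth_point_span s r : m s -> m r ->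
  (forall f, inv f -> cotangent_class u a b s r f) ->
  partial_x a b s * partial_y a b r != partial_x a b r * partial_y a b s ->
  exists t, [/\ max_ideal P u u a b t, ~ max_ideal_sq P u u a b t &
    forall f, max_ideal P u u a b f ->
      exists c : C, max_ideal_sq P u u a b (f - c%:P%:P * t)].
Proof.
move=> ms mr span det.
have Pi : inv P by rewrite /Defs.invariant P_inv subrr; apply: in_ideal0.
have [x [y]] := span P Pi; rewrite P_ab !polyC0 subr0 => Psr.
have [x0|x0] := eqVneq x 0; last exact: (smooth_point_core P_monic P_inv P_ab ms mr
  span det x0 Psr).
have [y0|y0] := eqVneq y 0; last first.
  apply: (smooth_point_core P_monic P_inv P_ab mr ms _ _ y0).
  - by move=> f fi; have [z [w fE]] := span f fi; exists w, z;
    rewrite [_ * r + _]addrC.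
  - by rewrite eq_sym.
  - by rewrite [_ * r + _]addrC; exact: Psr.
move: Psr; rewrite x0 y0 !polyC0 !mul0r addr0 subr0 => P2.
(* Here the ideal is zero, so an element of the square has the gradient of a multiple of 0. *)
have [c [cx cy]] := max_ideal_sq_grad (eval2C a b 0) P2.
by case: P_grad; rewrite ?cx ?cy ?partial_xC ?partial_yC mulr0 eqxx.
Qed.

Lemma smooth_point_coords U V :
  act2 u u U = cst u * U -> act2 u u V = cst u * V -> eval2 U a b != 0 ->
  (U = 'X%:P /\ V = 'X) \/ (U = 'X /\ V = 'X%:P) ->
  exists t, [/\ max_ideal P u u a b t, ~ max_ideal_sq P u u a b t &
    forall f, max_ideal P u u a b f ->
      exists c : C, max_ideal_sq P u u a b (f - c%:P%:P * t)].
Proof.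
move=> Uu Vu U0 UV.
have alg (A : comNzRingType) (c x y : A) : (c * x) ^+ 5 * (c * y) = c ^+ 6 * (x ^+ 5
  * y).
  by ring.
have w6 W : act2 u u W = cst u * W -> inv (U ^+ 5 * W).
  move=> Wu; rewrite /Defs.invariant act2M act2X Uu Wu alg -!polyC_exp.
  by rewrite (prim_expr_order u_prim) mul1r subrr; apply: in_ideal0.
have i6 : inv (U ^+ 6) by rewrite exprSr; apply: w6.
pose s := U ^+ 6 - cst (eval2 (U ^+ 6) a b).
pose r := U ^+ 5 * V - cst (eval2 (U ^+ 5 * V) a b).
have cU : cotangent_class u a b s r (U ^+ 6) by exact: cotangent_span_l.
have cV : cotangent_class u a b s r (U ^+ 5 * V) by exact: cotangent_span_r.
apply: (@smooth_point_span s r).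
- exact: max_ideal_sub.
- exact: max_ideal_sub (w6 _ Vu).
- apply: invariant_cotangent_class => // i j ij.
  case: UV => -[<- <-]; first exact: cotangent_class_monomial.
  by rewrite mulrC; apply: cotangent_class_monomial => //; rewrite addnC.
rewrite -subr_eq0; apply: jacobian_weight6 => //.
case: UV => -[-> ->]; last rewrite jacobianC oppr_eq0.
  by rewrite jacobian_xy oner_eq0.
by rewrite jacobian_xy oner_eq0.
Qed.

Lemma smooth_point : (a != 0) || (b != 0) ->
  exists t, [/\ max_ideal P u u a b t, ~ max_ideal_sq P u u a b t &
    forall f, max_ideal P u u a b f ->
      exists c : C, max_ideal_sq P u u a b (f - c%:P%:P * t)].
Proof.
case/orP => ab0.
  apply: (@smooth_point_coords 'X%:P 'X); last by left.
  - exact: act2_x.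
  - exact: act2_y.
  - by rewrite /eval2 hornerC hornerX.
apply: (@smooth_point_coords 'X 'X%:P); last by right.
- exact: act2_y.
- exact: act2_x.
- by rewrite /eval2 hornerX hornerC.
Qed.

End SmoothPoint.

(** * Critical points of the sextic *)

Section Sextic.
Variable K : numFieldType.
Implicit Types (p q : {poly K}) (a b c : K).

Lemma sextic_monic_size (A : comUnitRingType) (a1 a2 : A) :
  sextic a1 a2 \is monic /\ size (sextic a1 a2) = 7%N.
Proof.
have -> : sextic a1 a2 = 'X^6 + (- (a1 *: 'X^4) + (a1 ^+ 2 / 4) *: 'X^2 - a2%:P).
  by rewrite /sextic !addrA.
have s : (size (- (a1 *: 'X^4) + (a1 ^+ 2 / 4) *: 'X^2 - a2%:P)%R < 7)%N.
  apply: (leq_ltn_trans (size_polyD _ _)); rewrite gtn_max size_polyN.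
  rewrite [X in _ && X](leq_ltn_trans (size_polyC_leq1 _))// andbT.
  apply: (leq_ltn_trans (size_polyD _ _)); rewrite gtn_max size_polyN.
  by rewrite !(leq_ltn_trans (size_scale_leq _ _))// size_polyXn.
rewrite monicE lead_coefDl ?size_polyXn// lead_coefXn eqxx.
by rewrite size_polyDl ?size_polyXn.
Qed.

(** The variable, a_1 and a_2 carry weights 1, 2 and 6. This homogeneity yields the invariance under
    the symmetry, the gluing of the two charts and the scaling of characteristic polynomials. *)
Lemma sextic_scale (x1 x2 c : K) :
  sextic (c ^+ 2 * x1) (c ^+ 6 * x2) \Po (c *: 'X) = c ^+ 6 *: sextic x1 x2.
Proof.
apply/polyP => i; rewrite coef_comp_scale coefZ /sextic !coefB !coefD !coefN.
rewrite !coefZ !coefXn !coefC.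
by case: i => [|[|[|[|[|[|[|i]]]]]]] /=; field.
Qed.

Lemma polyC_inv_nat n : (n%:R : {poly K})^-1 = (n%:R^-1)%:P.
Proof. by rewrite -(polyC_natr _ n) polyCV. Qed.

Lemma fiber_sextic p q a : fiber a (sextic p q) = sextic p.[a] q.[a].
Proof.
have p4 : (4^-1 : {poly K}).[a] = 4^-1 by rewrite polyC_inv_nat hornerC.
apply/polyP => i; rewrite coef_fiber /sextic !coefB !coefD !coefN !coefZ.
rewrite !coefXn !coefC !(hornerD, hornerN, hornerM) p4 -?expr2.
by case: i => [|[|[|[|[|[|[|i]]]]]]] /=; rewrite ?hornerC ?horner0.
Qed.

(** With Q = m^3 - p m / 2 the sextic is Q^2 - q and its m-derivative is Q (6 m^2 - p). If Q = 0
    then q has a double zero at a; if p = 6 m^2 then Q = - 2 m^3 and 54 q = p^3 to second order. *)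
Lemma sextic_critical p q a b :
  (sextic p q).[b%:P].[a] = 0 ->
  partial_x a b (sextic p q) = 0 -> partial_y a b (sextic p q) = 0 ->
  (q.[a] = 0 /\ q^`().[a] = 0) \/
  (54 * q.[a] - p.[a] ^+ 3 = 0 /\
   54 * q^`().[a] - 3 * p.[a] ^+ 2 * p^`().[a] = 0).
Proof.
rewrite -horner_fiber /partial_y fiber_sextic /partial_x.
have -> : (sextic p q).[b%:P] = b ^+ 6 *: 1 - b ^+ 4 *: p + b ^+ 2 / 4 *: p ^+ 2 - q.
  rewrite /sextic polyC_inv_nat !(hornerD, hornerN, hornerZ) !hornerXn hornerC.
  rewrite -!mul_polyC mulr1 !polyC_exp polyCM polyC_exp. ring.
rewrite /sextic !(derivB, derivD, derivN, derivZ, derivXn, derivC, derivX, deriv_exp).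
rewrite !(hornerD, hornerN, hornerZ, hornerXn, hornerC, hornerMn, hornerM, horner0,
  horner_exp) /=.
move: p.[a] q.[a] p^`().[a] q^`().[a] => x y x' y' P0 Px Py.
pose w := b ^+ 3 - x * b / 2.
have yE : y = w ^+ 2 by apply/eqP; rewrite eq_sym -subr_eq0 -P0 /w; apply/eqP; field.
have y'E : y' = - (w * x' * b).
  by apply/eqP; rewrite eq_sym -subr_eq0 -Px /w; apply/eqP; field.
have /eqP : w * (6 * b ^+ 2 - x) = 0 by rewrite -Py /w; field.
rewrite mulf_eq0 => /orP[/eqP w0|]; first by left;
  rewrite yE y'E w0 expr0n !mul0r oppr0.
rewrite subr_eq0 => /eqP xE; right; rewrite yE y'E /w -xE.
by split; field.
Qed.

End Sextic.

(** * The spectral cover *)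

(** 54 a_2 - a_1^3 in the variable lambda = zeta^6: the cube of zeta^2 beta_1 supplies the factor
    lambda. *)
Definition branch_poly (A : comNzRingType) (p q : {poly A}) : {poly A} :=
  54%:R *: q - 'X * p ^+ 3.

Lemma map_branch_poly (A B : comNzRingType) (f : {rmorphism A -> B}) (p q : {poly A})
  :
  map_poly f (branch_poly p q) = branch_poly (map_poly f p) (map_poly f q).
Proof.
by rewrite rmorphB rmorphM/= map_polyX rmorphXn/= map_polyZ/= rmorph_nat.
Qed.

Section ChartPolynomial.
Variable K : numFieldType.

(** p and q stand for the numerators of b_1 and b_2. Clearing b_1 by zeta^(2 d) leaves zeta^2, since
    2 d - 12 k = 2, and clearing b_2 by zeta^(6 d) leaves no extra factor. *)
Definition chart_poly (p q : {poly K}) : {poly {poly K}} :=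
  sextic ('X^2 * (p \Po 'X^6)) (q \Po 'X^6).

Definition no_double_root (p : {poly K}) := forall x, root p x -> ~~ root p^`() x.

Definition generic_pair (p q : {poly K}) :=
  [/\ q.[0] != 0, no_double_root q & no_double_root (branch_poly p q)].

Lemma horner_comp_x6 (p : {poly K}) a : (p \Po 'X^6).[a] = p.[a ^+ 6].
Proof. by rewrite horner_comp hornerXn. Qed.

Lemma horner_x2_comp (p : {poly K}) a :
  ('X^2 * (p \Po 'X^6)).[a] = a ^+ 2 * p.[a ^+ 6].
Proof. by rewrite hornerM hornerXn horner_comp_x6. Qed.

Lemma chart_poly_fiber_inv u p q a : u ^+ 6 = 1 ->
  fiber (u * a) (chart_poly p q) \Po (u *: 'X) = fiber a (chart_poly p q).
Proof.
move=> u6; rewrite !fiber_sextic !horner_x2_comp !horner_comp_x6.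
have -> : (u * a) ^+ 2 * p.[(u * a) ^+ 6] = u ^+ 2 * (a ^+ 2 * p.[a ^+ 6]).
  by rewrite !exprMn u6 mul1r mulrA.
have -> : q.[(u * a) ^+ 6] = u ^+ 6 * q.[a ^+ 6] by rewrite exprMn u6 !mul1r.
by rewrite sextic_scale u6 scale1r.
Qed.

Lemma chart_poly_gradient p q a b : generic_pair p q ->
  (chart_poly p q).[b%:P].[a] = 0 ->
  partial_x a b (chart_poly p q) != 0 \/ partial_y a b (chart_poly p q) != 0.
Proof.
move=> [q0 nq nD] Pab; apply/orP; rewrite -negb_and; apply/andP => -[/eqP Px /eqP Py].
(* The map zeta -> zeta^6 is unramified away from 0, and f(0) <> 0 excludes 0, so a double root of
   f(zeta^6) at a comes from one of f at a^6. *)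
have key f : f.[0] != 0 -> no_double_root f -> (f \Po 'X^6).[a] = 0 ->
    (f \Po 'X^6)^`().[a] = 0 -> False.
  rewrite deriv_comp hornerM !horner_comp derivXn hornerMn !hornerXn/= => f0 nf fa.
  have a0 : a != 0 by apply: contraNneq f0 => a0; move: fa; rewrite a0 expr0n/= => ->.
  move=> /eqP; rewrite mulf_eq0 mulrn_eq0/= expf_eq0/= (negPf a0) orbF => f'a.
  by have := nf (a ^+ 6); rewrite /root fa eqxx f'a => /(_ isT).
have [[qa q'a]|[Da D'a]] := sextic_critical Pab Px Py; first exact: key q0 nq qa q'a.
have E : branch_poly p q \Po 'X^6 = 54%:R *: (q \Po 'X^6) - ('X^2 * (p \Po 'X^6)) ^+
  3.
  rewrite /branch_poly comp_polyB comp_polyZ comp_polyM comp_polyX exprMn -exprM.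
  by rewrite (rmorphXn (comp_poly 'X^6)).
apply: (key (branch_poly p q)) => //.
(* At lambda = 0 the branch polynomial takes the value 54 q(0). *)
- rewrite /branch_poly hornerD hornerN hornerZ hornerM hornerX mul0r subr0.
  by rewrite mulf_neq0// pnatr_eq0.
- by rewrite E hornerD hornerN hornerZ horner_exp.
- by rewrite E derivB derivZ deriv_exp hornerD hornerN hornerZ hornerMn hornerM
  horner_exp -D'a; ring.
Qed.

(** Hence q(0) <> 0 keeps the origin, the only fixed point of the symmetry in the chart, off the
    curve. *)
Lemma chart_poly_origin p q : (chart_poly p q).[0%:P].[0] = - q.[0].
Proof.
rewrite -horner_fiber fiber_sextic horner_x2_comp horner_comp_x6 /sextic.
rewrite !(hornerD, hornerN, hornerZ, hornerXn, hornerC) !expr0n/=; ring.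
Qed.

End ChartPolynomial.

Section SpectralCover.
Variable R : realType.
Local Notation C := (complex R).

Definition numer N (b : 'rV[C]_(N.*2.+1)) : {poly C} := \sum_j b 0 j *: 'X^j.

Definition rev_row N (b : 'rV[C]_(N.*2.+1)) : 'rV[C]_(N.*2.+1) :=
  \row_j b 0 (rev_ord j).

Lemma coef_numer N (b : 'rV[C]_(N.*2.+1)) (j : 'I_N.*2.+1) :
  (numer b)`_j = b 0 j.
Proof.
rewrite coef_sum (bigD1 j)//= coefZ coefXn eqxx mulr1 big1 ?addr0// => i ij.
by rewrite coefZ coefXn (_ : (_ == _) = false) ?mulr0//; apply: contraNF ij;
  rewrite eq_sym.
Qed.

Lemma laurentE N (b : 'rV[C]_(N.*2.+1)) x : x != 0 ->
  laurent b x = x ^- N * (numer b).[x].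
Proof.
move=> x0; rewrite horner_sum mulr_sumr; apply: eq_bigr => j _.
rewrite hornerZ hornerXn mulrCA; congr (_ * _).
by rewrite expfzDr// -exprnN mulrC.
Qed.

Lemma cleared0E N n (b : 'rV[C]_(N.*2.+1)) :
  cleared0 n b = 'X^(n - 6 * N) * (numer b \Po 'X^6).
Proof.
rewrite /numer raddf_sum mulr_sumr; apply: eq_bigr => j _ /=.
by rewrite comp_polyZ comp_Xn_poly -exprM -scalerAr -exprD addnC.
Qed.

Lemma clearedinfE N n (b : 'rV[C]_(N.*2.+1)) :
  clearedinf n b = cleared0 n (rev_row b).
Proof.
rewrite /clearedinf (reindex_inj rev_ord_inj)/=; apply: eq_bigr => j _.
by rewrite mxE subSS subKn// -ltnS.
Qed.

Lemma horner_clearedinf N n (b : 'rV[C]_(N.*2.+1)) a : a != 0 -> (6 * N <= n)%N ->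
  (clearedinf n b).[a^-1] = a^-1 ^+ n.*2 * (cleared0 n b).[a].
Proof.
move=> a0 Nn; rewrite !horner_sum mulr_sumr; apply: eq_bigr => j _.
rewrite !hornerZ !hornerXn mulrCA; congr (_ * _).
set r := (6 * (N.*2 - j) + _)%N; set s := (6 * j + _)%N.
have -> : n.*2 = (r + s)%N.
  rewrite /r /s; have := ltn_ord j; move: (nat_of_ord j) => i.
  by rewrite -!muln2; lia.
by rewrite exprD -mulrA -exprMn mulVf// expr1n mulr1.
Qed.

Lemma horner_conj (p : {poly C}) x :
  (map_poly (@Num.conj C) p).[x] = Num.conj p.[Num.conj x].
Proof. by rewrite -[in LHS](conjCK x) horner_map. Qed.

(** Multiplied by the N-th power of the conjugate of x, the reality condition becomes an identity of
    polynomials: the numerator read from infinity is the conjugate of the one read from zero. *)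
Lemma real_laurentP N (b : 'rV[C]_(N.*2.+1)) :
  real_laurent b <-> map_poly (@Num.conj C) (numer b) = numer (rev_row b).
Proof.
have revE x : x != 0 -> x ^+ N.*2 * (numer b).[x^-1] = (numer (rev_row b)).[x].
  move=> x0; rewrite !horner_sum mulr_sumr (reindex_inj rev_ord_inj)/=.
  apply: eq_bigr => j _; rewrite mxE !hornerZ !hornerXn mulrCA; congr (_ * _).
  by rewrite subSS exprVn -exprB ?leq_subr ?unitfE// subKn// -ltnS.
have lE x : x != 0 -> Num.conj (laurent b x) = Num.conj x ^- N * (map_poly (@Num.conj
  C) (numer b)).[Num.conj x].
  move=> x0; rewrite laurentE// rmorphM fmorphV rmorphXn/=.
  by rewrite horner_conj conjCK.
have rE x : x != 0 -> laurent b (Num.conj x)^-1 = Num.conj x ^- N * (numer (rev_row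
  b)).[Num.conj x].
  move=> x0; have cx0 : Num.conj x != 0 by rewrite fmorph_eq0.
  rewrite laurentE ?invr_eq0// -revE// exprVn invrK.
  by rewrite mulrA -addnn exprD mulrA mulVf ?mul1r// expf_neq0.
split=> [br|E x x0]; last by rewrite lE// rE// E.
apply: poly_eq_punctured => x x0; have cx0 : Num.conj x != 0 by rewrite fmorph_eq0.
have := br _ cx0; rewrite lE// rE// conjCK => /mulfI; apply.
by rewrite invr_eq0 expf_neq0.
Qed.

Lemma map_conj_root (p : {poly C}) x :
  root (map_poly (@Num.conj C) p) x = root p (Num.conj x).
Proof. by rewrite /root horner_conj fmorph_eq0. Qed.

(** Conjugation permutes roots together with their multiplicities; this carries genericity to the
    chart at infinity. *)
Lemma generic_pair_conj (p q : {poly C}) : generic_pair p q ->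
  generic_pair (map_poly (@Num.conj C) p) (map_poly (@Num.conj C) q).
Proof.
have ndr f : no_double_root f -> no_double_root (map_poly (@Num.conj C) f).
  by move=> nf x; rewrite deriv_map !map_conj_root; apply: nf.
move=> [q0 nq nD]; split; [|exact: ndr|].
  by rewrite horner_conj rmorph0 fmorph_eq0.
rewrite -(map_branch_poly (@Num.conj C)); exact: ndr.
Qed.

Lemma chart_poly_act2 (u : C) (p q : {poly C}) : u ^+ 6 = 1 ->
  act2 u u (chart_poly p q) = chart_poly p q.
Proof.
move=> u6; apply: fiber_inj => a _.
by rewrite fiber_act2; apply: chart_poly_fiber_inv.
Qed.

Lemma chart_smooth (u : C) (p q : {poly C}) : 6.-primitive_root u -> generic_pair p q
  ->
  smooth_chart (chart_poly p q) u u.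
Proof.
move=> up gpq a b Pab; have u6 := prim_expr_order up.
have [Pm sP] := sextic_monic_size ('X^2 * (p \Po 'X^6)) (q \Po 'X^6).
apply: (smooth_point up Pm (chart_poly_act2 _ _ u6) Pab).
  exact: chart_poly_gradient.
rewrite -negb_and; apply/andP => -[/eqP a0 /eqP b0].
case: gpq => /eqP + _ _; apply; move: Pab.
by rewrite a0 b0 /eval2 chart_poly_origin => /eqP; rewrite oppr_eq0 => /eqP.
Qed.

End SpectralCover.

(** * Genus and smoothness of [Sigma] *)

Section Sigma.
Variables (R : realType) (k : nat).
Local Notation C := (complex R).
Local Notation d := (6 * k + 1)%N.
Variable b : 'rV[C]_(k.*2.*2.+1) * 'rV[C]_((6 * k + 1).*2.+1).

Lemma Sigma_eq0 : eq0 (Sigma b) = chart_poly (numer b.1) (numer b.2).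
Proof.
rewrite /Sigma /= !cleared0E /chart_poly.
have -> : (d.*2 - 6 * k.*2)%N = 2 by rewrite -!muln2; lia.
by rewrite subnn expr0 mul1r.
Qed.

Lemma Sigma_eqinf :
  eqinf (Sigma b) = chart_poly (numer (rev_row b.1)) (numer (rev_row b.2)).
Proof.
rewrite /Sigma /= !clearedinfE !cleared0E /chart_poly.
have -> : (d.*2 - 6 * k.*2)%N = 2 by rewrite -!muln2; lia.
by rewrite subnn expr0 mul1r.
Qed.

Lemma Sigma_genus : has_genus (Sigma b) (5 * (6 * k + 1)).
Proof.
apply: cover_genus => //.
- by rewrite Sigma_eq0; exact: (sextic_monic_size _ _).1.
- by rewrite Sigma_eq0; exact: (sextic_monic_size _ _).2.
- by rewrite Sigma_eqinf; exact: (sextic_monic_size _ _).1.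
- by rewrite Sigma_eqinf; exact: (sextic_monic_size _ _).2.
- move=> a; rewrite Sigma_eq0; apply: chart_poly_fiber_inv.
  exact: prim_expr_order (epsilon_prim R).
move=> a a0; rewrite !fiber_sextic !horner_clearedinf//; last first.
  by rewrite -!muln2; lia.
(* Under the gluing n = c m the two equations differ by the unit c^6. *)
set c := a^-1 ^+ d.*2.
have -> : a^-1 ^+ d.*2.*2 = c ^+ 2 by rewrite -exprM muln2.
have -> : a^-1 ^+ (6 * d).*2 = c ^+ 6 
  by rewrite -exprM; congr (_ ^+ _); rewrite -!muln2; lia.
rewrite sextic_scale dvdpZr ?dvdpp//.
by rewrite !expf_neq0// invr_eq0.
Qed.

Lemma Sigma_smooth : BR b -> generic_pair (numer b.1) (numer b.2) ->
  smooth_quotient (Sigma b).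
Proof.
move=> [/real_laurentP b1 /real_laurentP b2] gb.
have e6 := epsilon_prim R.
have e'6 : 6.-primitive_root (epsilon R)^-1.
  have -> : (epsilon R)^-1 = epsilon R ^+ 5.
    apply: (mulIf (epsilon_neq0 R)).
    by rewrite mulVf ?epsilon_neq0// -exprSr (prim_expr_order e6).
  exact: (exp_prim_root e6 5).
split; rewrite [halfdeg _]/= ?exprVn epsilon_exp.
  by rewrite Sigma_eq0; apply: chart_smooth.
rewrite Sigma_eqinf -b1 -b2; apply: chart_smooth => //.
exact: generic_pair_conj.
Qed.

End Sigma.

(** * The main component read off from the characteristic polynomials *)

Section CharPolyScale.
Variable K : fieldType.

Lemma char_poly_scale n (c : K) (M : 'M[K]_n) :
  char_poly (c *: M) \Po (c *: 'X) = c ^+ n *: char_poly M.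
Proof.
rewrite /char_poly -det_map_mx -[c ^+ n *: _]mul_polyC polyC_exp -detZ;
  congr (\det _).
apply/matrixP => i j; rewrite !mxE rmorphB rmorphMn/= comp_polyC comp_polyX.
by rewrite -mul_polyC polyCM mulrBr mulrnAr.
Qed.

Lemma comp_scale_inj (c : K) : c != 0 -> injective (comp_poly (c *: 'X)).
Proof.
move=> c0 p q /polyP pq; apply/polyP => i; have := pq i.
by rewrite !coef_comp_scale => /mulfI; apply; rewrite expf_neq0.
Qed.

End CharPolyScale.

Section MainComponent.
Variables (R : realType) (k : nat).
Local Notation C := (complex R).
Local Notation d := (6 * k + 1)%N.
Local Notation plane := (R^o * R^o)%type.
Variables (b : 'rV[C]_(k.*2.*2.+1) * 'rV[C]_((6 * k + 1).*2.+1)).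
Variables (A : int -> plane -> 'M[C]_7) (z : plane).
Hypothesis Ab : spectral_data A b.

Lemma horner_cleared0 N n (v : 'rV[C]_(N.*2.+1)) a : a != 0 -> (6 * N <= n)%N ->
  (cleared0 n v).[a] = a ^+ n * laurent v (a ^+ 6).
Proof.
move=> a0 Nn; rewrite laurentE ?expf_neq0// cleared0E hornerM hornerXn.
by rewrite horner_comp_x6 mulrA -exprM -exprB ?unitfE.
Qed.

(** Scaling the matrix scales its eigenvalues, hence a_1 and a_2 by their weights 2 and 6; c =
    zeta^d and c = zeta^-d pass from mu to the coordinates m and n. *)
Lemma char_poly_killing_scale (zeta c : C) (M : 'M[C]_7) :
  zeta != 0 -> c != 0 -> M = c *: killing d A zeta z ->
  char_poly M = 'X * sextic (c ^+ 2 * laurent b.1 (zeta ^+ 6))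
                            (c ^+ 6 * laurent b.2 (zeta ^+ 6)).
Proof.
move=> z0 c0 ->; apply: (comp_scale_inj c0).
rewrite /= char_poly_scale Ab// comp_polyM comp_polyX sextic_scale.
by rewrite -scalerAl -scalerAr scalerA -exprS.
Qed.

Lemma horner_killing0 a : a != 0 ->
  map_mx (horner_eval a) (killing0 d A z) = a ^+ d *: killing d A a z.
Proof.
move=> a0; apply/matrixP => i j;
  rewrite !mxE !summxE horner_evalE horner_sum mulr_sumr.
apply: eq_bigr => s _; rewrite !mxE hornerM hornerXn hornerC mulrA; congr (_ * _).
by rewrite expfzDr// -exprnN mulrCA mulfV ?mulr1// expf_neq0.
Qed.

Lemma horner_killinginf a : a != 0 ->
  map_mx (horner_eval a^-1) (killinginf d A z) = a^-1 ^+ d *: killing d A a z.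
Proof.
move=> a0; apply/matrixP => i j;
  rewrite !mxE !summxE horner_evalE horner_sum mulr_sumr.
apply: eq_bigr => s _; rewrite !mxE hornerM hornerXn hornerC mulrA; congr (_ * _).
have key n t : (t <= n.*2)%N -> a^-1 ^+ (n.*2 - t) = a^-1 ^+ n * (a ^+ t / a ^+ n).
  move=> td; apply: (mulIf (expf_neq0 n.*2 a0)).
  rewrite -{2}(subnK td) exprD mulrA -exprMn mulVf// expr1n mul1r exprVn.
  by rewrite -addnn exprD mulrACA divfK ?expf_neq0// mulVf ?mul1r// expf_neq0.
by rewrite expfzDr// -exprnN key// -ltnS.
Qed.

Lemma char_poly_killing0 : char_poly (killing0 d A z) = 'X * eq0 (Sigma b).
Proof.
apply: fiber_inj => a a0.
rewrite map_char_poly horner_killing0// (char_poly_killing_scale a0 (expf_neq0 d a0)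
  erefl).
rewrite rmorphM/= map_polyX fiber_sextic !horner_cleared0//; last by rewrite -!muln2;
  lia.
by rewrite -!exprM muln2 [(d * 6)%N]mulnC.
Qed.

Lemma char_poly_killinginf : char_poly (killinginf d A z) = 'X * eqinf (Sigma b).
Proof.
apply: fiber_inj => w w0; have a0 : w^-1 != 0 by rewrite invr_eq0.
have kE := horner_killinginf a0; rewrite invrK in kE.
rewrite map_char_poly kE (char_poly_killing_scale a0 (expf_neq0 d w0) erefl).
have cE N n (v : 'rV[C]_(N.*2.+1)) : (6 * N <= n)%N ->
    (clearedinf n v).[w] = w ^+ n * laurent v (w^-1 ^+ 6).
  move=> Nn; rewrite -[in LHS](invrK w) horner_clearedinf// horner_cleared0// invrK.
  by rewrite -addnn exprD mulrA -[w ^+ n * w ^+ n * _]mulrA -exprMn mulfV// expr1n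
    mulr1.
rewrite rmorphM/= map_polyX fiber_sextic !cE//; last by rewrite -!muln2; lia.
by rewrite -!exprM muln2 [(d * 6)%N]mulnC.
Qed.

Lemma main_component_ofE : main_component_of d A z = Sigma b.
Proof.
have drop1 (p : {poly {poly C}}) : drop_poly 1 ('X * p) = p.
  by apply/polyP => i; rewrite coef_drop_poly coefXM addn1.
by rewrite /main_component_of char_poly_killing0 char_poly_killinginf !drop1.
Qed.

End MainComponent.

(** * Real dimension *)

Section RealDimension.
Variable R : realType.
Local Notation C := (complex R).
Local Open Scope complex_scope.

(** The images of the standard basis vectors under a real-linear injective parametrisation form a
    real basis. *)
Lemma real_dim_param (E : lmodType C) (V : E -> Prop) n (f : 'rV[R]_n -> E) :
  {morph f : x y / x + y} -> (forall c x, f (c *: x) = c%:C *: f x) ->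
  injective f -> (forall v, V v <-> exists x, v = f x) -> real_dim V n.
Proof.
move=> fD fZ fI fV; exists (fun i => f (delta_mx 0 i)).
have f0 : f 0 = 0 by rewrite -(scale0r 0) fZ scale0r.
have fE x : real_comb (fun i => f (delta_mx 0 i)) x = f x.
  rewrite [in RHS](row_sum_delta x) (big_morph f fD f0).
  by apply: eq_bigr => i _; rewrite fZ.
split=> [x y|v]; first by rewrite !fE => /fI.
by split=> [/fV[x ->]|[x ->]]; [exists x | apply/fV; exists x].
Qed.

Lemma real_dim_pair (E1 E2 : lmodType C) (V1 : E1 -> Prop) (V2 : E2 -> Prop) n1 n2 :
  real_dim V1 n1 -> real_dim V2 n2 ->
  real_dim (fun v : E1 * E2 => V1 v.1 /\ V2 v.2) (n1 + n2).
Proof.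
move=> [e1 [I1 B1]] [e2 [I2 B2]].
have combD (E : lmodType C) m (e : 'I_m -> E) : {morph real_comb e : x y / x + y}.
  move=> x y; rewrite /real_comb -big_split; apply: eq_bigr => i _ /=.
  by rewrite mxE rmorphD scalerDl.
have combZ (E : lmodType C) m (e : 'I_m -> E) c x :
    real_comb e (c *: x) = c%:C *: real_comb e x.
  rewrite /real_comb scaler_sumr; apply: eq_bigr => i _.
  by rewrite mxE rmorphM scalerA.
pose f (x : 'rV[R]_(n1 + n2)) := (real_comb e1 (lsubmx x), real_comb e2 (rsubmx x)).
apply: (@real_dim_param _ _ _ f).
- by move=> x y; rewrite /f !linearD !combD.
- by move=> c x; rewrite /f !linearZ !combZ.
- move=> x y [/I1 xy1 /I2 xy2].
  by rewrite -(hsubmxK x) -(hsubmxK y) xy1 xy2.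
move=> [v1 v2] /=; split=> [[/B1[x1 ->] /B2[x2 ->]]|[x [-> ->]]].
  by exists (row_mx x1 x2); rewrite /f row_mxKl row_mxKr.
by split; [apply/B1; eexists | apply/B2; eexists].
Qed.

Lemma real_laurent_coefP N (b : 'rV[C]_(N.*2.+1)) :
  real_laurent b <-> forall j, b 0 (rev_ord j) = Num.conj (b 0 j).
Proof.
have cE : map_poly (@Num.conj C) (numer b) = numer (map_mx (@Num.conj C) b).
  rewrite /numer rmorph_sum; apply: eq_bigr => j _ /=.
  by rewrite map_polyZ/= map_polyXn mxE.
rewrite real_laurentP cE; split=> [E j|E].
  by have := congr1 (fun p : {poly C} => p`_j) E; rewrite /= !coef_numer !mxE.
by congr numer; apply/rowP => j; rewrite !mxE E.
Qed.

(* The coefficients at j < N are the complex numbers x_j - i x_(2N - j), the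
   one at N is x_N. *)
Definition real_laurent_of N (x : 'rV[R]_(N.*2.+1)) : 'rV[C]_(N.*2.+1) :=
  \row_j if (j < N)%N then Complex (x 0 j) (- x 0 (rev_ord j))
         else if (j == N :> nat)%N then Complex (x 0 j) 0
         else Complex (x 0 (rev_ord j)) (x 0 j).

Lemma real_laurent_dim N : real_dim (@real_laurent R N) N.*2.+1.
Proof.
apply: (@real_dim_param _ _ _ (@real_laurent_of N)).
- move=> x y; apply/rowP => j; rewrite !mxE; do 2?case: ifP => _.
  + by rewrite opprD.
  + by apply/eqP; rewrite eq_complex/= addr0 !eqxx.
  + by [].
- move=> c x; apply/rowP => j; rewrite !mxE; do 2?case: ifP => _.
  + by apply/eqP; rewrite eq_complex/= !mul0r subr0 addr0 mulrN !eqxx.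
  + by apply/eqP; rewrite eq_complex/= !mul0r !mulr0 subr0 addr0 !eqxx.
  + by apply/eqP; rewrite eq_complex/= !mul0r subr0 addr0 !eqxx.
- move=> x y xy; apply/rowP => j; have /rowP/(_ j) := xy; rewrite !mxE.
  by case: ifP => _; [case | case: ifP => _ []].
move=> v; split=> [/real_laurent_coefP vr|[x ->]].
  (* Inverse parametrisation: real parts are read in the first half, imaginary parts at the mirrored
     conjugate coefficients in the second. *)
  exists (\row_j if (j <= N)%N then complex.Re (v 0 j) else complex.Im (v 0 j)).
  apply/rowP => j; rewrite !mxE /=.
  have rj := vr j; have jN := ltn_ord j; case: (ltngtP j N) => jN'.
  + rewrite (_ : (_ - _ <= N)%N = false); last by move: (nat_of_ord j) jN jN' => i;
    rewrite -!muln2; lia.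
    by rewrite rj; case: (v 0 j) => a c /=; rewrite opprK.
  + rewrite (_ : (_ - _ <= N)%N = true); last by move: (nat_of_ord j) jN jN' => i;
    rewrite -!muln2; lia.
    by rewrite rj; case: (v 0 j).
  (* The central coefficient is its own conjugate, so its imaginary part is zero. *)
  have jj : rev_ord j = j by apply: val_inj; rewrite /= jN' subSS -addnn addnK.
  move: rj; rewrite jj; case: (v 0 j) => a c [] /eqP.
  rewrite -addr_eq0 -mulr2n mulrn_eq0/= => /eqP ->.
  by [].
apply/real_laurent_coefP => j; rewrite !mxE rev_ordK /=.
have jN := ltn_ord j; case: (ltngtP j N) => jN'.
- rewrite (_ : (_ - _ < N)%N = false); last by move: (nat_of_ord j) jN jN' => i;
  rewrite -!muln2; lia.
  rewrite (_ : (_ - _ == N)%N = false); last by move: (nat_of_ord j) jN jN' => i;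
    rewrite -!muln2; lia.
  by apply/eqP; rewrite eq_complex/= opprK !eqxx.
- by rewrite (_ : (_ - _ < N)%N = true); last by move: (nat_of_ord j) jN jN' => i;
  rewrite -!muln2; lia.
rewrite (_ : (_ - _ < N)%N = false); last by move: (nat_of_ord j) jN jN' => i;
  rewrite -!muln2; lia.
rewrite (_ : (_ - _ == N)%N = true); last by move: (nat_of_ord j) jN jN' => i;
  rewrite -!muln2; lia.
have -> : rev_ord j = j by apply: val_inj; rewrite /= jN' subSS -addnn addnK.
by apply/eqP; rewrite eq_complex/= oppr0 !eqxx.
Qed.

(** The two summands contribute 4 k + 1 and 12 k + 3. *)
Lemma BR_dim k : real_dim (@BR R k) (16 * k + 4).
Proof.
have -> : (16 * k + 4 = k.*2.*2.+1 + (6 * k + 1).*2.+1)%N by rewrite -!muln2; lia.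
by apply: real_dim_pair; apply: real_laurent_dim.
Qed.

End RealDimension.

(** * Genericity *)

Section Discriminant.

(* [map_resultant] only covers morphisms defined on a polynomial ring. *)
Lemma rmorph_resultant (A B : nzRingType) (f : {rmorphism A -> B}) (p q : {poly A}) :
  f (lead_coef p) != 0 -> f (lead_coef q) != 0 ->
  f (resultant p q) = resultant (map_poly f p) (map_poly f q).
Proof.
move=> fp fq; rewrite /resultant /Sylvester_mx !size_map_poly_id0//.
rewrite -det_map_mx/= map_col_mx; congr (\det (col_mx _ _));
  by apply: map_lin1_mx => v; rewrite map_poly_rV rmorphM/= map_rVpoly.
Qed.

Lemma rmorph_lead_coef_neq0 (A B : nzRingType) (f : {rmorphism A -> B}) (p : {poly
  A}) :
  (0 < size (map_poly f p))%N -> (size p <= size (map_poly f p))%N ->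
  f (lead_coef p) != 0.
Proof.
move=> fp0 sp; have s : size (map_poly f p) = size p.
  by apply/eqP; rewrite eqn_leq sp size_poly.
rewrite /lead_coef -s -coef_map -/(lead_coef _) lead_coef_eq0.
by rewrite -size_poly_gt0.
Qed.

Variables (A : comNzRingType) (K : numFieldType).
Implicit Types (f : {rmorphism A -> K}) (q : {poly A}).

(** The resultant is a combination u q + v q', which specializes to 0 at a common root even when the
    degree drops under f. *)
Lemma no_double_root_of_resultant f q :
  (1 < size q)%N -> (1 < size q^`())%N -> f (resultant q q^`()) != 0 ->
  no_double_root (map_poly f q).
Proof.
move=> sq sq' r0 x /eqP qx; apply/negP => /eqP q'x.
have [[u v] _ /(congr1 (fun p => (map_poly f p).[x]))] := resultant_in_ideal sq sq'.
rewrite map_polyC/= hornerC rmorphD !rmorphM/= hornerD !hornerM -deriv_map.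
by rewrite qx q'x !mulr0 addr0 => /eqP; rewrite (negPf r0).
Qed.

(** The degrees of q and q' do not drop at this specialization, so the resultant commutes with f;
    X^n + 1 is separable in characteristic zero. *)
Lemma resultant_specialize f q n c : (1 < n)%N -> c != 0 ->
  (size q <= n.+1)%N -> map_poly f q = c *: ('X^n + 1) ->
  [/\ (1 < size q)%N, (1 < size q^`())%N & f (resultant q q^`()) != 0].
Proof.
move=> n1 c0 sq fq; have n0 : (0 < n)%N by apply: ltnW.
have sfq : size (map_poly f q) = n.+1.
  by rewrite fq size_scale// size_XnaddC.
have fq' : map_poly f q^`() = (c *+ n) *: 'X^(n.-1).
  by rewrite -deriv_map fq derivZ derivD derivXn derivC addr0 -scalerMnr scalerMnl.
have cn0 : c *+ n != 0 by rewrite mulrn_eq0 negb_or -lt0n n0.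
have sfq' : size (map_poly f q^`()) = n.
  by rewrite fq' size_scale// size_polyXn prednK.
have sq' : (size q^`() <= n)%N.
  apply/leq_sizeP => i ni; rewrite coef_deriv nth_default ?mul0rn//.
  exact: leq_trans sq _.
split.
- by rewrite (leq_trans n1)// ltnW// -sfq size_poly.
- by rewrite (leq_trans n1)// -sfq' size_poly.
rewrite rmorph_resultant; first last.
- by rewrite rmorph_lead_coef_neq0 ?sfq'.
- by rewrite rmorph_lead_coef_neq0 ?sfq.
rewrite resultant_eq0 -leqNgt fq fq'.
suff : coprimep (c *: ('X^n + 1)) ((c *+ n) *: 'X^(n.-1)).
  by rewrite /coprimep => /eqP ->.
rewrite coprimepZl// coprimepZr//; apply/Bezout_coprimepP.
(* Bezout relation (X^n + 1) - X X^(n-1) = 1. *)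
exists (1, - 'X); rewrite /= mul1r mulNr -exprS prednK// addrAC subrr add0r.
exact: eqpxx.
Qed.

End Discriminant.

Section Generic.
Variables (R : realType) (k : nat).
Local Notation C := (complex R).
Local Notation E := ('rV[C]_(k.*2.*2.+1) * 'rV[C]_((6 * k + 1).*2.+1))%type.
Local Notation N2 := ((6 * k + 1).*2)%N.
Variables (n : nat) (e : 'I_n -> E).
Hypothesis e_basis : real_basis (@BR R k) e.
Local Notation Mp := (mpoly.mpoly n C).

(** The numerator at a generic point: the real coordinates in the basis are the indeterminates, so
    the discriminant becomes a polynomial in them. *)
Definition generic_numer m (v : 'I_n -> 'rV[C]_m) : {poly Mp} :=
  \sum_(j < m) (\sum_i mpoly.mpolyC n (v i 0 j) * mpoly.mpolyX C (mpoly.mnm1 i)) *: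
    'X^j.

Definition real_point (x : 'rV[R]_n) : Mp -> C := mpoly.meval (fun i => (x 0 i)%:C%C).
HB.instance Definition _ x := GRing.RMorphism.on (real_point x).

Local Notation p1 := (generic_numer (fun i => (e i).1)).
Local Notation p2 := (generic_numer (fun i => (e i).2)).

Definition discriminant : Mp :=
  let D := branch_poly p1 p2 in
  resultant p2 p2^`() * resultant D D^`() * p2`_0.

Lemma size_generic_numer m (v : 'I_n -> 'rV[C]_m) : (size (generic_numer v) <= m)%N.
Proof.
apply: (leq_trans (size_sum _ _ _)); apply/bigmax_leqP => j _.
by apply: (leq_trans (size_scale_leq _ _)); rewrite size_polyXn.
Qed.

Lemma real_point_numer m (v : 'I_n -> 'rV[C]_m) x :
  map_poly (real_point x) (generic_numer v) =
  \sum_(j < m) (\sum_i (x 0 i)%:C%C *: v i) 0 j *: 'X^j.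
Proof.
rewrite /generic_numer rmorph_sum; apply: eq_bigr => j _ /=.
rewrite map_polyZ map_polyXn/= rmorph_sum summxE/=; congr (_ *: _).
apply: eq_bigr => i _; rewrite rmorphM mxE mulrC; congr (_ * _).
  exact: mpoly.mevalXU.
exact: mpoly.mevalC.
Qed.

Lemma real_comb_fst x : (real_comb e x).1 = \sum_i (x 0 i)%:C%C *: (e i).1.
Proof. by rewrite /real_comb (big_morph fst (id1 := 0) (op1 := +%R)). Qed.

Lemma real_comb_snd x : (real_comb e x).2 = \sum_i (x 0 i)%:C%C *: (e i).2.
Proof. by rewrite /real_comb (big_morph snd (id1 := 0) (op1 := +%R)). Qed.

Lemma real_point_p1 x : map_poly (real_point x) p1 = numer (real_comb e x).1.
Proof. by rewrite real_point_numer real_comb_fst. Qed.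

Lemma real_point_p2 x : map_poly (real_point x) p2 = numer (real_comb e x).2.
Proof. by rewrite real_point_numer real_comb_snd. Qed.

Lemma generic_example : exists x,
  numer (real_comb e x).1 = 0 /\ numer (real_comb e x).2 = 'X^N2 + 1.
Proof.
(* The coefficients of lambda^-(6 k + 1) + lambda^(6 k + 1), which is symmetric and therefore
   real. *)
pose w : 'rV[C]_(N2.+1) := \row_j ((j == ord0) || (j == ord_max))%:R.
have BRw : BR ((0, w) : E).
  split; apply/real_laurent_coefP => j; rewrite !mxE ?rmorph0// rmorph_nat.
  have rE i : (rev_ord j == i) = (j == rev_ord i).
    by rewrite -(inj_eq rev_ord_inj) rev_ordK.
  rewrite !rE orbC; congr (_ || _)%:R; congr (_ == _); apply: val_inj => /=.
    by rewrite subnn.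
  by rewrite subSS subn0.
have [x xE] := (e_basis.2 (0, w)).1 BRw; exists x; rewrite -xE; split.
  by rewrite /numer big1// => j _; rewrite mxE scale0r.
have N0 : (0 < N2)%N by rewrite double_gt0 addn1.
apply/polyP => i; rewrite coefD coefXn coef1.
have [iN|iN] := leqP i N2; last first.
  rewrite gtn_eqF// gtn_eqF ?(leq_trans N0 (ltnW iN))// addr0 coef_sum big1// => j _.
  rewrite coefZ coefXn gtn_eqF ?mulr0//.
  exact: leq_trans (ltn_ord j) iN.
transitivity (w 0 (Ordinal (iN : (i < N2.+1)%N)));
  first exact: (coef_numer w (Ordinal (iN : (i < N2.+1)%N))).
rewrite mxE -!val_eqE/=.
by case: eqP => [->|_]; case: eqP => //= i0; rewrite ?addr0 ?add0r//; move: N0;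
  rewrite -i0.
Qed.

Lemma discriminant_nondegenerate :
  (exists x, real_point x discriminant != 0) /\
  forall x, real_point x discriminant != 0 ->
    generic_pair (numer (real_comb e x).1) (numer (real_comb e x).2).
Proof.
have N2gt1 : (1 < N2)%N by rewrite -muln2; lia.
have [x [x1 x2]] := generic_example.
set D := branch_poly p1 p2.
have mapD y : map_poly (real_point y) D =
    branch_poly (numer (real_comb e y).1) (numer (real_comb e y).2).
  by rewrite map_branch_poly real_point_p1 real_point_p2.
have sp2 : (size p2 <= N2.+1)%N by apply: size_generic_numer.
(* lambda beta_1^3 has degree at most 12 k + 1, below the bound 12 k + 2 for beta_2; thus the degree
   of D does not drop at the example. *)
have sD : (size D <= N2.+1)%N.
  apply: (leq_trans (size_polyD _ _)); rewrite geq_max size_polyN.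
  rewrite (leq_trans (size_scale_leq _ _) sp2)/=.
  apply: (leq_trans (size_polyMleq _ _)); rewrite size_polyX.
  have := size_poly_exp_leq p1 3; have := size_generic_numer (fun i => (e i).1).
  by move: (size p1) (size (p1 ^+ 3)) => s1 s3; rewrite -!muln2; lia.
have x2' : map_poly (real_point x) p2 = 1 *: ('X^N2 + 1).
  by rewrite scale1r real_point_p2 x2.
have xD : map_poly (real_point x) D = 54%:R *: ('X^N2 + 1).
  by rewrite mapD x1 x2 /branch_poly expr0n mulr0 subr0.
have [s1 s1' r1] := resultant_specialize N2gt1 (oner_neq0 _) sp2 x2'.
have c54 : 54%:R != 0 :> C by rewrite pnatr_eq0.
have [s2 s2' r2] := resultant_specialize N2gt1 c54 sD xD.
have ev0 y : real_point y p2`_0 = (numer (real_comb e y).2).[0].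
  by rewrite horner_coef0 -real_point_p2 coef_map.
split.
  exists x; rewrite /discriminant !rmorphM/= !mulf_neq0//.
  by rewrite ev0 x2 hornerD hornerXn hornerC expr0n gtn_eqF ?add0r ?oner_eq0// ltnW.
move=> y; rewrite /discriminant !rmorphM/= !mulf_eq0 !negb_or -andbA ev0.
case/and3P=> d1 d2 d3; split=> //.
  by rewrite -real_point_p2; apply: no_double_root_of_resultant.
by rewrite -mapD; apply: no_double_root_of_resultant.
Qed.

(** At a real point the monomials are real, so a real-linear g applied to the coefficients may be
    applied to the value. With the real and imaginary parts, one complex equation becomes two real
    ones. *)
Lemma meval_map_mpoly (g : {additive C -> R}) (x : 'rV[R]_n) (W : Mp) :
  (forall c (r : R), g (c * r%:C%C) = g c * r) ->
  mpoly.meval (fun i => x 0 i) (mpoly.map_mpoly g W) = g (real_point x W).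
Proof.
move=> gM.
have -> : mpoly.map_mpoly g W =
    \sum_(m <- mpoly.msupp W) g (mpoly.mcoeff m W) *: mpoly.mpolyX R m.
  rewrite {1}(mpoly.mpolyE W) (raddf_sum (mpoly.map_mpoly g)); apply: eq_bigr => m _.
  apply/mpoly.mpolyP => m'; rewrite mpoly.mcoeff_map_mpoly !mpoly.mcoeffZ
    !mpoly.mcoeffX.
  by case: eqP; rewrite ?mulr1 ?mulr0 ?raddf0.
rewrite /real_point [mpoly.meval _ W]mpoly.mevalE (raddf_sum (mpoly.meval _))
  (raddf_sum g).
apply: eq_bigr => m _; rewrite /= mpoly.mevalZ mpoly.mevalX -gM; congr (g (_ * _)).
by rewrite rmorph_prod; apply: eq_bigr => i _; rewrite rmorphXn.
Qed.

Definition discriminant_locus (v : E) :=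
  exists2 x, v = real_comb e x & real_point x discriminant = 0.

Lemma discriminant_locus_lower_dim : lower_dim_subvariety (@BR R k)
  discriminant_locus.
Proof.
pose re := mpoly.map_mpoly (@complex.Re R) discriminant.
pose im := mpoly.map_mpoly (@complex.Im R) discriminant.
have reE (x : 'rV[R]_n) : mpoly.meval (fun i => x 0 i) re = complex.Re (real_point x
  discriminant).
  by apply: meval_map_mpoly => -[a b] r /=; rewrite mulr0 subr0.
have imE (x : 'rV[R]_n) : mpoly.meval (fun i => x 0 i) im = complex.Im (real_point x
  discriminant).
  by apply: meval_map_mpoly => -[a b] r /=; rewrite mulr0 add0r.
have zeroE (x : 'rV[R]_n) : real_point x discriminant = 0 <->
    mpoly.meval (fun i => x 0 i) re = 0 /\ mpoly.meval (fun i => x 0 i) im = 0.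
  rewrite reE imE; split=> [->//|]; case: (real_point x discriminant) => a b /=.
  by move=> [-> ->].
exists n, e, (fun p => p = re \/ p = im); split=> //.
  have [[x x0] _] := discriminant_nondegenerate.
  (* The two real polynomials cannot both vanish identically, since the discriminant is nonzero at
     some real point. *)
  have [re0|re0] := eqVneq re 0; last by exists re; [left|].
  exists im; first by right.
  apply: contraNneq x0 => im0; apply/eqP/zeroE.
  by rewrite re0 im0 !raddf0.
move=> v; split=> [[x vE /zeroE[r0 i0]]|[x vE I0]]; exists x => //.
  by move=> p [->|->].
by apply/zeroE; split; apply: I0; [left|right].
Qed.

Lemma generic_off_discriminant_locus b : BR b -> ~ discriminant_locus b ->
  generic_pair (numer b.1) (numer b.2).
Proof.
move=> /(e_basis.2 b).1[x bE] nZ; rewrite bE.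
apply: discriminant_nondegenerate.2; apply/eqP => x0.
by apply: nZ; exists x.
Qed.

End Generic.

Theorem theorem3p1 (R : realType) (k : nat) :
  real_dim (@BR R k) (16 * k + 4)%N /\
  exists Z, lower_dim_subvariety (@BR R k) Z /\
    (forall b, BR b -> ~ Z b ->
      smooth_quotient (Sigma b) /\ has_genus (Sigma b) (5 * (6 * k + 1))%N) /\
    (forall (f : R^o * R^o -> 'cV[R]_7)
        (A : int -> R^o * R^o -> 'M[complex R]_7) b (z : R^o * R^o),
      almost_complex_immersion f -> ~ isotropic f ->
      finite_type_with f (6 * k + 1) A ->
      BR b -> spectral_data A b -> ~ Z b ->
      smooth_quotient (main_component_of (6 * k + 1) A z) /\
      has_genus (main_component_of (6 * k + 1) A z) (5 * (6 * k + 1))%N).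
Proof.
split; first exact: BR_dim.
have [e e_basis] := BR_dim R k.
exists (discriminant_locus e); split; first exact: discriminant_locus_lower_dim.
have generic b : BR b -> ~ discriminant_locus e b ->
    smooth_quotient (Sigma b) /\ has_genus (Sigma b) (5 * (6 * k + 1))%N.
  move=> bR bZ; split; last exact: Sigma_genus.
  exact: Sigma_smooth (generic_off_discriminant_locus e_basis bR bZ).
split=> // f A b z _ _ _ bR Ab bZ.
by rewrite (main_component_ofE z Ab); apply: generic.
Qed.
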